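(* Given an array $A$ of $n$ $w$-bit integers, one can construct an in-place partial sums data structure for $A$ that supports $\mathsf{sum}$ and $\mathsf{update}$ operations in $O(\log \log n)$ time on a restricted UWRAM.
   Context: Partial sums problem: maintain an array $A[1,\ldots,n]$ of integers under the operations $\mathsf{sum}(i)$, which returns $\sum_{k\le i} A[k]$, and $\mathsf{update}(i,\Delta)$, which sets $A[i]\leftarrow A[i]+\Delta$. The word RAM has $w$-bit words with $w \ge \log n$; time is the number of instructions. The ultra-wide word RAM (UWRAM) extends the word RAM with ultrawords of $w^2$ bits (viewed as $w$ words of $w$ bits). The restricted UWRAM supports on ultrawords: addition, subtraction, shifts, and bitwise boolean operations, plus standard memory access (reading/writing a single word or $w$ contiguous words) and scattered memory access (given an ultraword of $w$ addresses, a scattered read loads the contents of these $w$ possibly non-contiguous locations into an ultraword, and a scattered write stores the $w$ words of an ultraword into these locations), each in constant time. An in-place data structure for the partial sums problem may modify the input array $A$ (e.g., replace its entries) and, in addition to the modified array, may store only $O(1)$ ultrawords. *)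

(* Defs.v *)
From Stdlib Require Export ZArith List.
Export ListNotations.
Open Scope Z_scope.

(** * The restricted ultra-wide word RAM

    A word is an integer in [0, 2^w) and an ultraword an integer in
    [0, 2^(w*w)).  Bits [w*j .. w*j + w - 1] of an ultraword form its word
    number [j], for [0 <= j < w]. *)

Definition to_word (w x : Z) : Z := x mod 2 ^ w.
Definition to_ultra (w x : Z) : Z := x mod 2 ^ (w * w).

Definition slots (w : Z) : list Z := map Z.of_nat (seq 0 (Z.to_nat w)).

Definition words_of (w u : Z) : list Z :=
  map (fun j => (u / 2 ^ (w * j)) mod 2 ^ w) (slots w).

(* The head of the list becomes the least significant word. *)
Definition ultra_of (w : Z) (l : list Z) : Z :=
  fold_right (fun x u => x + 2 ^ w * u) 0 l.

(* All results are truncated to w bits, so Add and Sub wrap around; division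
   and remainder are unsigned. *)
Inductive word_op := WAdd | WSub | WMul | WDiv | WMod | WAnd | WOr | WXor
                   | WShl | WShr.

Definition eval_word_op (w : Z) (o : word_op) (x y : Z) : Z :=
  to_word w
    match o with
    | WAdd => x + y
    | WSub => x - y
    | WMul => x * y
    | WDiv => x / y
    | WMod => x mod y
    | WAnd => Z.land x y
    | WOr => Z.lor x y
    | WXor => Z.lxor x y
    | WShl => Z.shiftl x y
    | WShr => Z.shiftr x y
    end.

(* The restricted model has no multiplication on ultrawords.  The operands are
   w*w-bit integers: carries do cross word boundaries.  Complement is
   subtraction from the all-ones ultraword 0 - 1. *)
Inductive ultra_op := UAdd | USub | UAnd | UOr | UXor.

Definition eval_ultra_op (w : Z) (o : ultra_op) (x y : Z) : Z :=
  to_ultra w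
    match o with
    | UAdd => x + y
    | USub => x - y
    | UAnd => Z.land x y
    | UOr => Z.lor x y
    | UXor => Z.lxor x y
    end.

(* Every nat argument is a register number, except for jump targets, which are
   positions in the program.  Destinations come first.  WtoU zero-extends a
   word register to an ultraword register, UtoW keeps the least significant
   word; they move data between the two kinds of registers. *)
Inductive instr :=
| WConst (d : nat) (c : Z)
| WOp (o : word_op) (d a b : nat)
| UOp (o : ultra_op) (d a b : nat)
| UShl (d a b : nat)                (* shift amount in word register b *)
| UShr (d a b : nat)
| WtoU (d a : nat)
| UtoW (d a : nat)
| WLoad (d a : nat)                 (* d := M[a] *)
| WStore (a b : nat)                (* M[a] := b *)
| ULoad (d a : nat)                 (* d := M[a .. a+w-1] *)
| UStore (a b : nat)
| Gather (d a : nat)                (* scattered read *)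
| Scatter (a b : nat)               (* scattered write *)
| Jump (l : nat)
| JumpEq (a b l : nat)
| JumpLt (a b l : nat)
| Halt.

Definition program := list instr.

(* The lists fix the number of word registers, of ultraword registers and of
   accessible memory cells: no instruction changes their lengths, and using a
   register or a memory cell that does not exist is a fault.  The cell number
   j of [mem] has address [base + j]. *)
Record state := State {
  pc : nat;
  wregs : list Z;
  uregs : list Z;
  mem : list Z
}.

Fixpoint set_nth (l : list Z) (i : nat) (v : Z) : option (list Z) :=
  match l, i with
  | [], _ => None
  | _ :: l', O => Some (v :: l')
  | x :: l', S i' => option_map (cons x) (set_nth l' i' v)
  end.

Definition bind {X Y : Type} (o : option X) (f : X -> option Y) : option Y :=
  match o with Some x => f x | None => None end.

Notation "x <- e ;; f" := (bind e (fun x => f))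
  (at level 61, e at next level, right associativity).

Definition read_cell (base : Z) (m : list Z) (a : Z) : option Z :=
  if base <=? a then nth_error m (Z.to_nat (a - base)) else None.

Definition write_cell (base : Z) (m : list Z) (a v : Z) : option (list Z) :=
  if base <=? a then set_nth m (Z.to_nat (a - base)) v else None.

Fixpoint read_cells (base : Z) (m : list Z) (l : list Z) : option (list Z) :=
  match l with
  | [] => Some []
  | a :: l' =>
      x <- read_cell base m a ;;
      xs <- read_cells base m l' ;;
      Some (x :: xs)
  end.

(* [l] is a list of address-value pairs. *)
Fixpoint write_cells (base : Z) (m : list Z) (l : list (Z * Z))
    : option (list Z) :=
  match l with
  | [] => Some m
  | (a, v) :: l' =>
      m' <- write_cell base m a v ;; write_cells base m' l'
  end.

(* A scattered write of different values to one address is a fault, so that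
   nothing depends on how a machine resolves such conflicts. *)
Definition conflict_free (l : list (Z * Z)) : bool :=
  forallb (fun p =>
    forallb (fun q => implb (fst p =? fst q) (snd p =? snd q)) l) l.

Definition scatter (base : Z) (m : list Z) (l : list (Z * Z))
    : option (list Z) :=
  if conflict_free l then write_cells base m l else None.

Definition consecutive (w a : Z) : list Z := map (fun j => a + j) (slots w).

Definition getw (s : state) (r : nat) : option Z := nth_error (wregs s) r.
Definition getu (s : state) (r : nat) : option Z := nth_error (uregs s) r.

Definition next_setw (s : state) (d : nat) (v : Z) : option state :=
  l <- set_nth (wregs s) d v ;;
  Some (State (S (pc s)) l (uregs s) (mem s)).

Definition next_setu (s : state) (d : nat) (v : Z) : option state :=
  l <- set_nth (uregs s) d v ;;
  Some (State (S (pc s)) (wregs s) l (mem s)).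

Definition next_setm (s : state) (om : option (list Z)) : option state :=
  m <- om ;; Some (State (S (pc s)) (wregs s) (uregs s) m).

Definition goto (s : state) (l : nat) : state :=
  State l (wregs s) (uregs s) (mem s).

Definition exec_instr (w base : Z) (i : instr) (s : state) : option state :=
  match i with
  | WConst d c => next_setw s d (to_word w c)
  | WOp o d a b =>
      x <- getw s a ;; y <- getw s b ;; next_setw s d (eval_word_op w o x y)
  | UOp o d a b =>
      x <- getu s a ;; y <- getu s b ;; next_setu s d (eval_ultra_op w o x y)
  | UShl d a b =>
      x <- getu s a ;; k <- getw s b ;;
      next_setu s d (to_ultra w (Z.shiftl x k))
  | UShr d a b =>
      x <- getu s a ;; k <- getw s b ;;
      next_setu s d (to_ultra w (Z.shiftr x k))
  | WtoU d a => x <- getw s a ;; next_setu s d x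
  | UtoW d a => x <- getu s a ;; next_setw s d (to_word w x)
  | WLoad d a =>
      x <- getw s a ;; v <- read_cell base (mem s) x ;; next_setw s d v
  | WStore a b =>
      x <- getw s a ;; v <- getw s b ;;
      next_setm s (write_cell base (mem s) x v)
  | ULoad d a =>
      x <- getw s a ;; l <- read_cells base (mem s) (consecutive w x) ;;
      next_setu s d (ultra_of w l)
  | UStore a b =>
      x <- getw s a ;; u <- getu s b ;;
      next_setm s
        (write_cells base (mem s) (combine (consecutive w x) (words_of w u)))
  | Gather d a =>
      x <- getu s a ;; l <- read_cells base (mem s) (words_of w x) ;;
      next_setu s d (ultra_of w l)
  | Scatter a b =>
      x <- getu s a ;; u <- getu s b ;;
      next_setm s
        (scatter base (mem s) (combine (words_of w x) (words_of w u)))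
  | Jump l => Some (goto s l)
  | JumpEq a b l =>
      x <- getw s a ;; y <- getw s b ;;
      Some (goto s (if x =? y then l else S (pc s)))
  | JumpLt a b l =>
      x <- getw s a ;; y <- getw s b ;;
      Some (goto s (if x <? y then l else S (pc s)))
  | Halt => None
  end.

(* [run w base p t s s']: from [s], program [p] reaches a Halt instruction in
   state [s'] after executing [t] instructions, Halt included. *)
Inductive run (w base : Z) (p : program) : nat -> state -> state -> Prop :=
| run_halt (s : state) :
    nth_error p (pc s) = Some Halt -> run w base p 1 s s
| run_step (i : instr) (t : nat) (s s1 s2 : state) :
    nth_error p (pc s) = Some i ->
    exec_instr w base i s = Some s1 ->
    run w base p t s1 s2 ->
    run w base p (S t) s s2.

(** * In-place partial sums *)

(* Signed and unsigned w-bit integers are both allowed; they are stored as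
   their residues modulo 2^w. *)
Definition wbit (w x : Z) : Prop := - 2 ^ (w - 1) <= x < 2 ^ w.

(* The array fills the whole accessible memory, so that besides it there are
   only [k + 3] words and [k] ultrawords, all in registers.  The size of the
   array is passed modulo 2^w, like all arguments below; this matters only if
   it is 2^w, which is then passed as 0. *)
Definition initial (w base : Z) (k : nat) (A : list Z) : state :=
  State 0
    ([base; to_word w (Z.of_nat (length A)); to_word w w] ++ repeat 0 k)
    (repeat 0 k)
    (map (to_word w) A).

(* Starting a program with the given arguments in the first word registers;
   all other registers and the memory are kept. *)
Definition call (w : Z) (args : list Z) (s : state) : state :=
  State 0
    (map (to_word w) args ++ skipn (length args) (wregs s))
    (uregs s) (mem s).

Definition result (s : state) : Z := nth 0 (wregs s) 0.

(* Array positions are numbered from 1: A[i] is [nth (i - 1) A 0]. *)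
Definition psum (A : list Z) (i : Z) : Z :=
  fold_right Z.add 0 (firstn (Z.to_nat i) A).

Definition add_at (A : list Z) (i d : Z) : list Z :=
  firstn (Z.to_nat (i - 1)) A
  ++ match skipn (Z.to_nat (i - 1)) A with
     | [] => []
     | x :: A' => (x + d) :: A'
     end.

Inductive operation := Sum (i : Z) | Update (i d : Z).

Definition valid_op (w n : Z) (o : operation) : Prop :=
  match o with
  | Sum i => 1 <= i <= n
  | Update i d => 1 <= i <= n /\ wbit w d
  end.

(* From the machine state [s], in which the data structure represents [A], the
   operations in [ops] are executed one after the other, each within [T]
   instructions, and every sum is answered correctly modulo 2^w. *)
Fixpoint serves (w base : Z) (sum_p update_p : program) (T : Z)
    (ops : list operation) (A : list Z) (s : state) : Prop :=
  match ops with
  | [] => True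
  | Sum i :: ops' =>
      exists (t : nat) (s' : state),
        run w base sum_p t (call w [i] s) s' /\
        Z.of_nat t <= T /\
        result s' = to_word w (psum A i) /\
        serves w base sum_p update_p T ops' A s'
  | Update i d :: ops' =>
      exists (t : nat) (s' : state),
        run w base update_p t (call w [i; d] s) s' /\
        Z.of_nat t <= T /\
        serves w base sum_p update_p T ops' (add_at A i d) s'
  end.

(* Main.v *)
Require Import Defs.
From Stdlib Require Import ZArith List Lia Bool.
Open Scope Z_scope.

(** The array is turned into a Fenwick tree whose cell 0 holds A[1] and whose
    cell q >= 1 holds the sum of the entries after position [q & (q - 1)] up to
    position q, positions being counted from 0.  Then the prefix sum up to x is
    the sum of cell 0 and of the cells obtained from x by clearing its lowest j
    bits, over the set bits j of x; an update of position x + 1 changes exactly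
    the cells [(x | (2^j - 1)) + 1] inside the array and cell x + 1.  There is
    one candidate cell for each of the w values of j, so one scattered access
    reaches all of them.  Clearing and setting low bits, and masking, is
    bitwise, and the words read by a sum query are added pairwise in
    log log n rounds, by repeatedly adding a copy shifted by 1, 2, 4, ... words.
    The initial tree is built by inserting the entries one by one, from the
    last to the second. *)

(** * Ultrawords as functions on slots *)

(** Two obstacles shape the proof. Carries cross word boundaries and ultrawords cannot be
    multiplied, so wordwise sums, tests and masks must be arranged so that no word overflows; the
    lemmas on [pack] isolate these range conditions. And no cell exists beyond the array: the root 0
    of the tree, which an indexing from 1 leaves empty, has to receive the first entry, and
    candidates of an update that fall outside the array must be redirected. They go to cell x + 1,
    which is a candidate anyway, and repeated candidates do not conflict because the word written
    depends only on the cell. A query takes log log n instead of log w rounds because only set bits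
    of x yield nonzero words: the summation stops as soon as its windows cover the bits of x.
    Building from the last entry downward works in place since inserting an entry touches only cells
    at or after its own position, while the cells before it still hold the input. *)

Definition pack (w : Z) (f : Z -> Z) : Z := ultra_of w (map f (slots w)).

Lemma in_slots (w j : Z) : In j (slots w) <-> 0 <= j < w.
Proof.
  unfold slots. rewrite in_map_iff. split.
  - intros (k & <- & H%in_seq). lia.
  - intros H. exists (Z.to_nat j). rewrite in_seq. lia.
Qed.

Lemma length_slots (w : Z) : length (slots w) = Z.to_nat w.
Proof. unfold slots. now rewrite length_map, length_seq. Qed.

Lemma pack_ext (w : Z) (f g : Z -> Z) :
  (forall j, 0 <= j < w -> f j = g j) -> pack w f = pack w g.
Proof.
  intros H. unfold pack. f_equal. apply map_ext_in.
  intros j Hj%in_slots. auto.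
Qed.

Definition words_in (w : Z) (f : Z -> Z) : Prop :=
  forall j, 0 <= j < w -> 0 <= f j < 2 ^ w.

Lemma words_in_slots (w : Z) (f : Z -> Z) :
  words_in w f -> Forall (fun x => 0 <= x < 2 ^ w) (map f (slots w)).
Proof.
  intros H. apply Forall_map, Forall_forall. intros j Hj%in_slots. auto.
Qed.

Lemma ultra_of_range (w : Z) (l : list Z) :
  0 <= w -> Forall (fun x => 0 <= x < 2 ^ w) l ->
  0 <= ultra_of w l < 2 ^ (w * Z.of_nat (length l)).
Proof.
  intros Hw. induction 1 as [|x l Hx _ IH].
  - cbn [length ultra_of fold_right]. now rewrite Z.mul_0_r.
  - cbn [length]. change (ultra_of w (x :: l)) with (x + 2 ^ w * ultra_of w l).
    replace (w * Z.of_nat (S (length l)))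
      with (w + w * Z.of_nat (length l)) by lia.
    rewrite Z.pow_add_r by nia. nia.
Qed.

Lemma pack_range (w : Z) (f : Z -> Z) :
  0 <= w -> words_in w f -> 0 <= pack w f < 2 ^ (w * w).
Proof.
  intros Hw Hf. pose proof (ultra_of_range w _ Hw (words_in_slots w f Hf)) as H.
  now rewrite length_map, length_slots, Z2Nat.id in H.
Qed.

Lemma to_ultra_pack (w : Z) (f : Z -> Z) :
  0 <= w -> words_in w f -> to_ultra w (pack w f) = pack w f.
Proof. intros. apply Z.mod_small. now apply pack_range. Qed.

Lemma ultra_of_word (w : Z) (l : list Z) (k : nat) :
  0 <= w -> Forall (fun x => 0 <= x < 2 ^ w) l ->
  (ultra_of w l / 2 ^ (w * Z.of_nat k)) mod 2 ^ w = nth k l 0.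
Proof.
  intros Hw Hl. revert k. induction Hl as [|x l Hx _ IH]; intros k.
  - cbn [ultra_of fold_right]. rewrite Zdiv_0_l, Zmod_0_l. now destruct k.
  - change (ultra_of w (x :: l)) with (x + 2 ^ w * ultra_of w l).
    destruct k as [|k].
    + rewrite Z.mul_0_r, Z.div_1_r. cbn [nth].
      rewrite Z.mul_comm, Z_mod_plus_full. now apply Z.mod_small.
    + replace (w * Z.of_nat (S k)) with (w + w * Z.of_nat k) by lia.
      rewrite Z.pow_add_r, <- Z.div_div by lia.
      rewrite (Z.mul_comm (2 ^ w)), Z.div_add, (Z.div_small x) by lia.
      apply IH.
Qed.

Lemma words_of_pack (w : Z) (f : Z -> Z) :
  0 <= w -> words_in w f -> words_of w (pack w f) = map f (slots w).
Proof.
  intros Hw Hf. unfold words_of. apply map_ext_in. intros j Hj%in_slots.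
  replace j with (Z.of_nat (Z.to_nat j)) at 1 by lia.
  unfold pack. rewrite ultra_of_word by auto using words_in_slots.
  rewrite nth_indep with (d' := f 0)
    by (rewrite length_map, length_slots; lia).
  unfold slots. rewrite map_nth, map_nth with (d := 0%nat), seq_nth by lia.
  f_equal. lia.
Qed.

(** An ultraword is a polynomial in [2 ^ w] whose coefficients are its words, so [pack] is linear
    even where words leave their range; the range matters only once a result is truncated. *)
Lemma pack_add (w : Z) (f g : Z -> Z) :
  pack w (fun j => f j + g j) = pack w f + pack w g.
Proof.
  unfold pack, ultra_of. induction (slots w) as [|j l IH]; cbn; [easy|].
  rewrite IH. ring.
Qed.

Lemma pack_scale (w c : Z) (f : Z -> Z) :
  pack w (fun j => c * f j) = c * pack w f.
Proof.
  unfold pack, ultra_of. induction (slots w) as [|j l IH]; cbn; [lia|].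
  rewrite IH. ring.
Qed.

Lemma pack_sub (w : Z) (f g : Z -> Z) :
  pack w (fun j => f j - g j) = pack w f - pack w g.
Proof.
  rewrite (pack_ext w _ (fun j => f j + -1 * g j)) by (intros; ring).
  rewrite pack_add, pack_scale. ring.
Qed.

Lemma testbit_concat (k x u n : Z) :
  0 <= k -> 0 <= x < 2 ^ k -> 0 <= n ->
  Z.testbit (x + 2 ^ k * u) n =
  if n <? k then Z.testbit x n else Z.testbit u (n - k).
Proof.
  intros Hk Hx Hn. destruct (Z.ltb_spec n k).
  - rewrite <- (Z.mod_pow2_bits_low (x + 2 ^ k * u) k) by lia.
    now rewrite Z.mul_comm, Z_mod_plus_full, Z.mod_small.
  - replace n with (n - k + k) at 1 by lia.
    rewrite <- Z.div_pow2_bits by lia.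
    now rewrite Z.mul_comm, Z.div_add, Z.div_small by lia.
Qed.

Section Bitwise.
  Variables (op : Z -> Z -> Z) (bop : bool -> bool -> bool).
  Hypothesis op_spec : forall a b n,
    Z.testbit (op a b) n = bop (Z.testbit a n) (Z.testbit b n).
  Hypothesis bop_false : bop false false = false.

  (** The condition on [bop false false] keeps all bits from position [k] on equal to zero. *)
  Lemma bitwise_range (k x y : Z) :
    0 <= k -> 0 <= x < 2 ^ k -> 0 <= y < 2 ^ k -> 0 <= op x y < 2 ^ k.
  Proof.
    intros Hk Hx Hy.
    assert (H : op x y = op x y mod 2 ^ k).
    { apply Z.bits_inj'. intros n Hn. destruct (Z.ltb_spec n k).
      - now rewrite Z.mod_pow2_bits_low.
      - rewrite Z.mod_pow2_bits_high, op_spec by lia.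
        rewrite <- (Z.mod_small x (2 ^ k)), <- (Z.mod_small y (2 ^ k)) by lia.
        now rewrite !Z.mod_pow2_bits_high by lia. }
    rewrite H. apply Z.mod_pos_bound. lia.
  Qed.

  Lemma bitwise_concat (k x y u v : Z) :
    0 <= k -> 0 <= x < 2 ^ k -> 0 <= y < 2 ^ k ->
    op (x + 2 ^ k * u) (y + 2 ^ k * v) = op x y + 2 ^ k * op u v.
  Proof.
    intros Hk Hx Hy. apply Z.bits_inj'. intros n Hn.
    pose proof (bitwise_range k x y Hk Hx Hy).
    rewrite op_spec, !testbit_concat by lia.
    now destruct (n <? k); rewrite op_spec.
  Qed.

  Lemma bitwise_pack (w : Z) (f g : Z -> Z) :
    0 <= w -> words_in w f -> words_in w g ->
    op (pack w f) (pack w g) = pack w (fun j => op (f j) (g j)).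
  Proof.
    intros Hw Hf Hg. unfold pack.
    apply words_in_slots in Hf, Hg. revert Hf Hg.
    induction (slots w) as [|j l IH]; intros Hf Hg.
    - apply Z.bits_inj'. intros n Hn. rewrite op_spec. cbn.
      now rewrite Z.bits_0.
    - inversion_clear Hf. inversion_clear Hg. cbn.
      rewrite bitwise_concat by auto. f_equal. f_equal. now apply IH.
  Qed.
End Bitwise.

Definition land_range :=
  bitwise_range Z.land andb Z.land_spec eq_refl.
Definition lor_range := bitwise_range Z.lor orb Z.lor_spec eq_refl.
Definition lxor_range := bitwise_range Z.lxor xorb Z.lxor_spec eq_refl.
Definition land_concat := bitwise_concat Z.land andb Z.land_spec eq_refl.
Definition lor_concat := bitwise_concat Z.lor orb Z.lor_spec eq_refl.

Lemma uand_pack (w : Z) (f g : Z -> Z) :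
  0 <= w -> words_in w f -> words_in w g ->
  eval_ultra_op w UAnd (pack w f) (pack w g) =
  pack w (fun j => Z.land (f j) (g j)).
Proof.
  intros Hw Hf Hg. unfold eval_ultra_op.
  rewrite (bitwise_pack _ _ Z.land_spec eq_refl) by easy.
  apply to_ultra_pack; [easy|]. intros j Hj. apply land_range; auto.
Qed.

Lemma uor_pack (w : Z) (f g : Z -> Z) :
  0 <= w -> words_in w f -> words_in w g ->
  eval_ultra_op w UOr (pack w f) (pack w g) =
  pack w (fun j => Z.lor (f j) (g j)).
Proof.
  intros Hw Hf Hg. unfold eval_ultra_op.
  rewrite (bitwise_pack _ _ Z.lor_spec eq_refl) by easy.
  apply to_ultra_pack; [easy|]. intros j Hj. apply lor_range; auto.
Qed.

Lemma uxor_pack (w : Z) (f g : Z -> Z) :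
  0 <= w -> words_in w f -> words_in w g ->
  eval_ultra_op w UXor (pack w f) (pack w g) =
  pack w (fun j => Z.lxor (f j) (g j)).
Proof.
  intros Hw Hf Hg. unfold eval_ultra_op.
  rewrite (bitwise_pack _ _ Z.lxor_spec eq_refl) by easy.
  apply to_ultra_pack; [easy|]. intros j Hj. apply lxor_range; auto.
Qed.

Lemma uadd_pack (w : Z) (f g : Z -> Z) :
  0 <= w -> words_in w (fun j => f j + g j) ->
  eval_ultra_op w UAdd (pack w f) (pack w g) = pack w (fun j => f j + g j).
Proof.
  intros. unfold eval_ultra_op. rewrite <- pack_add. now apply to_ultra_pack.
Qed.

Lemma usub_pack (w : Z) (f g : Z -> Z) :
  0 <= w -> words_in w (fun j => f j - g j) ->
  eval_ultra_op w USub (pack w f) (pack w g) = pack w (fun j => f j - g j).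
Proof.
  intros. unfold eval_ultra_op. rewrite <- pack_sub. now apply to_ultra_pack.
Qed.

(** Division by [2 ^ w] drops word 0. A zero word appended at the top, which is [f w], restores the
    length, so that the remaining words again fill all slots. *)
Lemma pack_tail (w : Z) (f : Z -> Z) :
  0 <= w -> words_in w f -> f w = 0 ->
  pack w f / 2 ^ w = pack w (fun j => f (j + 1)).
Proof.
  intros Hw Hf H0. unfold pack, slots.
  assert (Hz : forall l, ultra_of w (l ++ [0]) = ultra_of w l).
  { unfold ultra_of. induction l as [|x l IH]; cbn [app fold_right]; lia. }
  set (n := Z.to_nat w) in *.
  rewrite <- Hz.
  assert (Hs : map f (map Z.of_nat (seq 0 n)) ++ [0] =
               f 0 :: map (fun j => f (j + 1)) (map Z.of_nat (seq 0 n))).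
  { replace [0] with (map f (map Z.of_nat [(0 + n)%nat]))
      by (cbn; f_equal; rewrite <- H0; f_equal; lia).
    rewrite <- !map_app, <- seq_S. cbn [seq map]. f_equal.
    rewrite <- seq_shift, !map_map. apply map_ext. intros; f_equal; lia. }
  rewrite Hs. unfold ultra_of at 1. cbn [fold_right].
  rewrite Z.mul_comm, Z.div_add by lia. rewrite Z.div_small; [easy|].
  destruct (Z.eq_dec w 0) as [->|]; [rewrite H0; lia|].
  apply Hf. lia.
Qed.

(** The vanishing of [f] from slot [w] on stands for the zeros that a right shift brings in. *)
Lemma shiftr_pack (w : Z) (f : Z -> Z) (c : nat) :
  0 <= w -> words_in w f -> (forall j, w <= j -> f j = 0) ->
  Z.shiftr (pack w f) (w * Z.of_nat c) =
  pack w (fun j => f (j + Z.of_nat c)).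
Proof.
  intros Hw. revert f. induction c as [|c IH]; intros f Hf H0.
  - rewrite Z.mul_0_r, Z.shiftr_0_r. apply pack_ext. intros; f_equal; lia.
  - replace (w * Z.of_nat (S c)) with (w + w * Z.of_nat c) by lia.
    rewrite <- Z.shiftr_shiftr by nia.
    rewrite (Z.shiftr_div_pow2 (pack w f)), pack_tail
      by auto with zarith.
    rewrite IH.
    + apply pack_ext. intros; f_equal; lia.
    + intros j Hj. destruct (Z.eq_dec (j + 1) w).
      * rewrite H0; lia.
      * apply Hf. lia.
    + intros. apply H0. lia.
Qed.


(** * Wordwise test for zero and wordwise addition *)

Lemma half_word (w : Z) : 1 <= w -> 2 ^ w = 2 * 2 ^ (w - 1).
Proof. intros. rewrite <- Z.pow_succ_r by lia. f_equal. lia. Qed.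

Lemma testbit_top (w x : Z) :
  1 <= w -> 0 <= x < 2 ^ w ->
  Z.testbit x (w - 1) = (2 ^ (w - 1) <=? x).
Proof.
  intros Hw Hx. pose proof (half_word w Hw).
  rewrite Z.testbit_eqb by lia. destruct (Z.leb_spec (2 ^ (w - 1)) x).
  - replace (x / 2 ^ (w - 1)) with 1; [easy|].
    apply Z.div_unique with (x - 2 ^ (w - 1)); lia.
  - now rewrite Z.div_small by lia.
Qed.

Lemma land_pow2 (x j : Z) :
  0 <= j -> Z.land x (2 ^ j) = if Z.testbit x j then 2 ^ j else 0.
Proof.
  intros Hj. apply Z.bits_inj'. intros n Hn.
  rewrite Z.land_spec, Z.pow2_bits_eqb by lia.
  destruct (Z.eqb_spec j n) as [->|Hne].
  - destruct (Z.testbit x n).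
    + now rewrite Z.pow2_bits_true.
    + now rewrite Z.bits_0.
  - rewrite andb_false_r. destruct (Z.testbit x j).
    + now rewrite Z.pow2_bits_false.
    + now rewrite Z.bits_0.
Qed.

Lemma land_low (k x : Z) : 0 <= k -> Z.land x (2 ^ k - 1) = x mod 2 ^ k.
Proof. intros. rewrite <- Z.land_ones, Z.ones_equiv by lia. f_equal. Qed.

Definition low (w : Z) : Z -> Z := fun _ => 2 ^ (w - 1) - 1.
Definition high (w : Z) : Z -> Z := fun _ => 2 ^ (w - 1).

(* Adding [2^(w-1) - 1] to the low bits of a word carries into its top bit
   unless they are all zero. *)
Definition nonzero_flags (w x : Z) : Z :=
  eval_ultra_op w UAnd
    (eval_ultra_op w UOr
      (eval_ultra_op w UAdd
        (eval_ultra_op w UAnd x (pack w (low w))) (pack w (low w))) x)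
    (pack w (high w)).

(** A flag [t = 2 ^ (w - 1)] gives [(t - 1) + t = 2 ^ w - 1] and a flag 0 gives 0, with neither a
    borrow nor a carry out of the word. *)
Definition nonzero_mask (w x : Z) : Z :=
  let t := nonzero_flags w x in
  eval_ultra_op w UAdd
    (eval_ultra_op w USub t (to_ultra w (Z.shiftr t (w - 1)))) t.

(** The carry detects only the low bits; the disjunction with [x] catches a set top bit. *)
Lemma nonzero_flag (w x : Z) :
  1 <= w -> 0 <= x < 2 ^ w ->
  Z.land (Z.lor (Z.land x (2 ^ (w - 1) - 1) + (2 ^ (w - 1) - 1)) x)
    (2 ^ (w - 1)) = 2 ^ (w - 1) * if x =? 0 then 0 else 1.
Proof.
  intros Hw Hx. pose proof (half_word w Hw) as H2.
  rewrite land_pow2, Z.lor_spec, land_low by lia.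
  pose proof (Z.mod_pos_bound x (2 ^ (w - 1)) ltac:(lia)).
  rewrite !testbit_top by lia.
  destruct (Z.leb_spec (2 ^ (w - 1)) x).
  - rewrite orb_true_r. destruct (Z.eqb_spec x 0); lia.
  - rewrite Z.mod_small, orb_false_r by lia.
    destruct (Z.leb_spec (2 ^ (w - 1)) (x + (2 ^ (w - 1) - 1)));
      destruct (Z.eqb_spec x 0); lia.
Qed.

Lemma nonzero_mask_pack (w : Z) (f : Z -> Z) :
  1 <= w -> words_in w f ->
  nonzero_mask w (pack w f) =
  pack w (fun j => if f j =? 0 then 0 else 2 ^ w - 1).
Proof.
  intros Hw Hf. pose proof (half_word w Hw) as H2.
  assert (Hl : words_in w (low w)) by (intros j Hj; unfold low; lia).
  assert (Hh : words_in w (high w)) by (intros j Hj; unfold high; lia).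
  assert (Hs : words_in w (fun j => Z.land (f j) (low w j) + low w j)).
  { intros j Hj. unfold low. rewrite land_low by lia.
    pose proof (Z.mod_pos_bound (f j) (2 ^ (w - 1)) ltac:(lia)). lia. }
  assert (Ht : nonzero_flags w (pack w f) =
    pack w (fun j => 2 ^ (w - 1) * if f j =? 0 then 0 else 1)).
  { unfold nonzero_flags.
    rewrite (uand_pack w f), uadd_pack, uor_pack, uand_pack; try easy; try lia.
    - apply pack_ext. intros j Hj. now apply nonzero_flag, Hf.
    - intros j Hj. apply lor_range; auto with zarith. }
  unfold nonzero_mask. rewrite Ht.
  replace (to_ultra w (Z.shiftr _ (w - 1)))
    with (pack w (fun j => if f j =? 0 then 0 else 1)).
  - rewrite usub_pack, uadd_pack; try lia.
    + apply pack_ext. intros j Hj. destruct (f j =? 0); lia.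
    + intros j Hj. destruct (f j =? 0); lia.
    + intros j Hj. destruct (f j =? 0); lia.
  (* All flags are multiples of [2 ^ (w - 1)], so the shift is an exact division and no bit enters a
     neighbouring word. *)
  - rewrite pack_scale, Z.shiftr_div_pow2, Z.mul_comm, Z.div_mul by lia.
    rewrite to_ultra_pack; [easy|lia|].
    intros j Hj. destruct (f j =? 0); lia.
Qed.

(** The low [w - 1] bits of two words add up within one word; the top bits are then added without
    carry, by exclusive or. *)
Definition wordwise_add (w x y : Z) : Z :=
  eval_ultra_op w UXor
    (eval_ultra_op w UAdd
      (eval_ultra_op w UAnd x (pack w (low w)))
      (eval_ultra_op w UAnd y (pack w (low w))))
    (eval_ultra_op w UAnd (eval_ultra_op w UXor x y) (pack w (high w))).

Lemma lxor_top (w s : Z) :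
  1 <= w -> 0 <= s < 2 ^ w ->
  Z.lxor s (2 ^ (w - 1)) = (s + 2 ^ (w - 1)) mod 2 ^ w.
Proof.
  intros Hw Hs. pose proof (half_word w Hw) as H2.
  set (h := 2 ^ (w - 1)) in *.
  assert (Hx : forall a u v, 0 <= a < h ->
    Z.lxor (a + h * u) (h * v) = a + h * Z.lxor u v).
  { intros a u v Ha.
    pose proof (bitwise_concat Z.lxor xorb Z.lxor_spec eq_refl
      (w - 1) a 0 u v ltac:(lia) Ha ltac:(lia)) as E.
    now rewrite Z.lxor_0_r in E. }
  destruct (Z.ltb_spec s h).
  - rewrite Z.mod_small by lia. specialize (Hx s 0 1 ltac:(lia)).
    rewrite Z.mul_0_r, Z.add_0_r, Z.mul_1_r in Hx. rewrite Hx. cbn. lia.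
  - replace (s + h) with (s - h + 1 * 2 ^ w) by lia.
    rewrite Z_mod_plus_full, Z.mod_small by lia.
    specialize (Hx (s - h) 1 1 ltac:(lia)).
    rewrite Z.mul_1_r in Hx. replace (s - h + h) with s in Hx by lia.
    rewrite Hx. cbn. lia.
Qed.

(** With [h = 2 ^ (w - 1)], the sum of the residues modulo [h] misses [h] once for each set top bit.
    One missing [h] is supplied by flipping the top bit; two make [2 ^ w], which vanishes. *)
Lemma wordwise_add_word (w x y : Z) :
  1 <= w -> 0 <= x < 2 ^ w -> 0 <= y < 2 ^ w ->
  Z.lxor (Z.land x (2 ^ (w - 1) - 1) + Z.land y (2 ^ (w - 1) - 1))
    (Z.land (Z.lxor x y) (2 ^ (w - 1))) = to_word w (x + y).
Proof.
  intros Hw Hx Hy. pose proof (half_word w Hw) as H2.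
  rewrite !land_low, land_pow2, Z.lxor_spec, !testbit_top by lia.
  unfold to_word. pose proof (lxor_top w) as Ht.
  set (h := 2 ^ (w - 1)) in *.
  assert (Hm : forall z, 0 <= z < 2 ^ w ->
    z mod h = if h <=? z then z - h else z).
  { intros z Hz. destruct (Z.leb_spec h z).
    - symmetry. apply Z.mod_unique_pos with 1; lia.
    - apply Z.mod_small; lia. }
  rewrite !Hm by lia.
  destruct (Z.leb_spec h x), (Z.leb_spec h y); cbn [xorb];
    rewrite ?Z.lxor_0_r, ?Ht by lia.
  - apply Z.mod_unique_pos with 1; lia.
  - f_equal; lia.
  - f_equal; lia.
  - now rewrite Z.mod_small by lia.
Qed.

Lemma wordwise_add_pack (w : Z) (f g : Z -> Z) :
  1 <= w -> words_in w f -> words_in w g ->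
  wordwise_add w (pack w f) (pack w g) =
  pack w (fun j => to_word w (f j + g j)).
Proof.
  intros Hw Hf Hg. pose proof (half_word w Hw) as H2.
  assert (Hl : words_in w (low w)) by (intros j Hj; unfold low; lia).
  assert (Hh : words_in w (high w)) by (intros j Hj; unfold high; lia).
  assert (Hx : words_in w (fun j => Z.lxor (f j) (g j)))
    by (intros j Hj; apply lxor_range; auto with zarith).
  assert (Hs : words_in w
    (fun j => Z.land (f j) (low w j) + Z.land (g j) (low w j))).
  { intros j Hj. unfold low. rewrite !land_low by lia.
    pose proof (Z.mod_pos_bound (f j) (2 ^ (w - 1)) ltac:(lia)).
    pose proof (Z.mod_pos_bound (g j) (2 ^ (w - 1)) ltac:(lia)). lia. }
  unfold wordwise_add.
  rewrite (uand_pack w f), (uand_pack w g), uadd_pack, (uxor_pack w f),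
    uand_pack, uxor_pack; try easy; try lia.
  - apply pack_ext. intros j Hj. apply wordwise_add_word; auto.
  - intros j Hj. apply land_range; auto with zarith.
Qed.

(** * The tree *)

Definition down (j m : Z) : Z := m / 2 ^ j * 2 ^ j.

Lemma down_le (j m : Z) : 0 <= j -> down j m <= m.
Proof. intros. unfold down. pose proof (Z.mul_div_le m (2 ^ j)). nia. Qed.

Lemma down_nonneg (j m : Z) : 0 <= j -> 0 <= m -> 0 <= down j m.
Proof.
  intros. unfold down. pose proof (Z.div_pos m (2 ^ j) ltac:(lia)). nia.
Qed.

Lemma down_small (j m : Z) : 0 <= m < 2 ^ j -> down j m = 0.
Proof. intros. unfold down. now rewrite Z.div_small. Qed.

Lemma down_0 (m : Z) : down 0 m = m.
Proof. unfold down. rewrite Z.pow_0_r, Z.div_1_r. lia. Qed.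

Lemma land_upper (w j m : Z) :
  0 <= j <= w -> 0 <= m < 2 ^ w -> Z.land m (2 ^ w - 2 ^ j) = down j m.
Proof.
  intros Hj Hm. pose proof (Z.pow_le_mono_r 2 j w ltac:(lia) ltac:(lia)).
  pose proof (Z.div_mod m (2 ^ j) ltac:(lia)) as E.
  pose proof (Z.mod_pos_bound m (2 ^ j) ltac:(lia)).
  assert (Hq : 0 <= m / 2 ^ j < 2 ^ (w - j)).
  { split; [apply Z.div_pos; lia|]. apply Z.div_lt_upper_bound; [lia|].
    rewrite <- Z.pow_add_r by lia. now replace (j + (w - j)) with w by lia. }
  rewrite E at 1. replace (2 ^ w - 2 ^ j) with (0 + 2 ^ j * (2 ^ (w - j) - 1)).
  - rewrite Z.add_comm, land_concat, Z.land_0_r, land_low, Z.mod_small by lia.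
    unfold down. lia.
  - rewrite Z.mul_sub_distr_l, <- Z.pow_add_r by lia.
    replace (j + (w - j)) with w by lia. lia.
Qed.

Lemma lor_lower (j m : Z) :
  0 <= j -> Z.lor m (2 ^ j - 1) = down j m + (2 ^ j - 1).
Proof.
  intros Hj. pose proof (Z.div_mod m (2 ^ j) ltac:(lia)) as E.
  pose proof (Z.mod_pos_bound m (2 ^ j) ltac:(lia)).
  rewrite E at 1. replace (2 ^ j - 1) with (2 ^ j - 1 + 2 ^ j * 0) at 1 by lia.
  rewrite Z.add_comm, lor_concat, Z.lor_0_r by lia.
  enough (Z.lor (m mod 2 ^ j) (2 ^ j - 1) = 2 ^ j - 1) by (unfold down; lia).
  change (2 ^ j - 1) with (Z.pred (2 ^ j)). rewrite <- Z.ones_equiv.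
  apply Z.bits_inj'. intros n Hn. rewrite Z.lor_spec.
  destruct (Z.ltb_spec n j).
  - now rewrite Z.ones_spec_low, orb_true_r by lia.
  - now rewrite Z.mod_pow2_bits_high, Z.ones_spec_high by lia.
Qed.

Lemma down_step (j m : Z) :
  0 <= j -> down j m = down (j + 1) m + if Z.testbit m j then 2 ^ j else 0.
Proof.
  intros Hj. unfold down.
  rewrite Z.testbit_eqb, Z.pow_add_r, Z.pow_1_r, <- Z.div_div by lia.
  pose proof (Z.div_mod (m / 2 ^ j) 2 ltac:(lia)).
  pose proof (Z.mod_pos_bound (m / 2 ^ j) 2 ltac:(lia)).
  destruct (Z.eqb_spec ((m / 2 ^ j) mod 2) 1); nia.
Qed.

(** For positive [q] this clears the lowest set bit. *)
Definition parent (q : Z) : Z := Z.land q (q - 1).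

Lemma parent_multiple (j a : Z) :
  0 <= j -> parent (2 ^ j * (a + 1)) = 2 ^ j * Z.land (a + 1) a.
Proof.
  intros Hj. unfold parent.
  replace (2 ^ j * (a + 1) - 1) with (2 ^ j - 1 + 2 ^ j * a) by lia.
  replace (2 ^ j * (a + 1)) with (0 + 2 ^ j * (a + 1)) by lia.
  rewrite land_concat by lia. now rewrite Z.land_0_l.
Qed.

(** The bits of [b] inside and outside [a] form two nonnegative numbers that add up to [b]. *)
Lemma land_le_r (a b : Z) : 0 <= a -> 0 <= b -> 0 <= Z.land a b <= b.
Proof.
  intros. split; [apply Z.land_nonneg; lia|].
  pose proof (Z.add_lor_land (Z.ldiff b a) (Z.land b a)) as E.
  rewrite Z.lor_ldiff_and, (Z.land_comm b a), Z.land_assoc, Z.land_ldiff in E.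
  pose proof (proj2 (Z.ldiff_nonneg b a)). rewrite Z.land_0_l in E. lia.
Qed.

Lemma parent_range (q : Z) : 1 <= q -> 0 <= parent q <= q - 1.
Proof. intros. apply land_le_r; lia. Qed.

Lemma land_succ_double (b : Z) : Z.land (2 * b + 1) (2 * b) = 2 * b.
Proof.
  replace (2 * b + 1) with (1 + 2 ^ 1 * b) by lia.
  replace (2 * b) with (0 + 2 ^ 1 * b) at 1 by lia.
  rewrite land_concat by lia. rewrite Z.land_diag, Z.land_0_r. lia.
Qed.

(** A set bit [j] of [m] is the lowest set bit of [down j m]. Hence the cells read by a sum query
    form a chain of parents, along which node values telescope. *)
Lemma parent_down (j m : Z) :
  0 <= j -> Z.testbit m j = true -> parent (down j m) = down (j + 1) m.
Proof.
  intros Hj Hb. pose proof (down_step j m Hj) as E. rewrite Hb in E.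
  unfold down at 2 in E. rewrite Z.pow_add_r, Z.pow_1_r in E by lia.
  set (b := m / (2 ^ j * 2)) in *.
  replace (down j m) with (2 ^ j * (2 * b + 1)) by nia.
  rewrite parent_multiple, land_succ_double by lia.
  unfold down. rewrite Z.pow_add_r, Z.pow_1_r by lia. fold b. ring.
Qed.

(** The exponent [j] is the position of the lowest set bit; it tells which word of an update reaches
    cell [q]. *)
Lemma odd_part (q : Z) :
  1 <= q -> exists j b, 0 <= j /\ 0 <= b /\ q = 2 ^ j * (2 * b + 1).
Proof.
  intros Hq. rewrite <- (Z2Nat.id q) in * by lia.
  induction (Z.to_nat q) as [n IH] using lt_wf_ind.
  destruct (Z.Even_or_Odd (Z.of_nat n)) as [[k Hk]|[k Hk]].
  - destruct (IH (Z.to_nat k)) as (j & b & Hj & Hb & E); [lia..|].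
    exists (j + 1), b. repeat split; [lia..|].
    rewrite Z.pow_add_r by lia. lia.
  - exists 0, k. lia.
Qed.

(* Word number [j] of the ultraword of cells that [update_code] changes when it
   is called on position [x + 1] of [0..N]. *)
Definition target (w N x j : Z) : Z :=
  Z.lor x
    (Z.land
      (if Z.lxor (Z.land x (2 ^ w - 2 ^ j)) (down j N) =? 0
       then 0 else 2 ^ w - 1)
      (2 ^ j - 1)) + 1.

Section Target.
  Variables w N x : Z.
  Hypothesis (Hw : 0 <= w) (HN : N < 2 ^ w) (Hx : 0 <= x < N).

  (** The exclusive or tells whether [x] and [N] agree from bit [j] on. If so, the next multiple of
      [2 ^ j] after [x] exceeds [N], and the zero mask redirects the word to [x + 1]; otherwise
      setting the low bits and adding 1 gives that multiple. *)
  Lemma target_eq (j : Z) :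
    0 <= j < w ->
    target w N x j =
    if x / 2 ^ j <? N / 2 ^ j then (x / 2 ^ j + 1) * 2 ^ j else x + 1.
  Proof.
    intros Hj. unfold target. rewrite land_upper by lia.
    pose proof (Z.div_le_mono x N (2 ^ j) ltac:(lia) ltac:(lia)).
    destruct (Z.eqb_spec (Z.lxor (down j x) (down j N)) 0) as [E|E].
    - apply Z.lxor_eq in E. unfold down in E.
      rewrite Z.mul_cancel_r in E by lia.
      rewrite Z.land_0_l, Z.lor_0_r.
      destruct (Z.ltb_spec (x / 2 ^ j) (N / 2 ^ j)); lia.
    - destruct (Z.ltb_spec (x / 2 ^ j) (N / 2 ^ j)).
      + rewrite Z.land_comm, land_low, Z.mod_small by
          (pose proof (Z.pow_lt_mono_r 2 j w); lia).
        rewrite lor_lower by lia. unfold down. lia.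
      + elim E. apply Z.lxor_eq_0_iff. unfold down. f_equal. lia.
  Qed.

  Lemma target_range (j : Z) : 0 <= j < w -> x < target w N x j <= N.
  Proof.
    intros Hj. rewrite target_eq by lia.
    pose proof (Z.div_mod x (2 ^ j) ltac:(lia)).
    pose proof (Z.mod_pos_bound x (2 ^ j) ltac:(lia)).
    pose proof (Z.mul_div_le N (2 ^ j) ltac:(lia)).
    destruct (Z.ltb_spec (x / 2 ^ j) (N / 2 ^ j)); nia.
  Qed.

  (** The right side says that position [x + 1] lies in the range of cell [q]. For
      [q = 2 ^ j * (2 * b + 1)] this range begins after [2 ^ j * (2 * b)], so [q] is the next
      multiple of [2 ^ j] after [x]. Conversely, the parent of a next multiple [2 ^ j * (a + 1)] is
      at most [2 ^ j * a], hence at most [x]. *)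
  Lemma target_iff (q : Z) :
    1 <= q <= N ->
    (exists j, 0 <= j < w /\ target w N x j = q) <-> parent q <= x < q.
  Proof.
    intros Hq. split.
    - intros (j & Hj & <-). split; [|apply target_range; lia].
      rewrite target_eq by lia.
      destruct (Z.ltb_spec (x / 2 ^ j) (N / 2 ^ j)).
      + rewrite Z.mul_comm, parent_multiple by lia.
        pose proof (Z.div_pos x (2 ^ j) ltac:(lia)).
        pose proof (land_le_r (x / 2 ^ j + 1) (x / 2 ^ j)).
        pose proof (Z.mul_div_le x (2 ^ j)). nia.
      + pose proof (parent_range (x + 1)). lia.
    - intros [Hp Hlt]. destruct (odd_part q) as (j & b & Hj & Hb & E); [lia|].
      (* [2 ^ j] divides [q], and [q <= N < 2 ^ w]. *)
      assert (Hjw : j < w).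
      { apply (Z.pow_lt_mono_r_iff 2); [lia..|]. nia. }
      exists j. split; [lia|]. rewrite target_eq by lia. rewrite E in Hp, Hlt.
      rewrite parent_multiple, land_succ_double in Hp by lia.
      assert (Hd : x / 2 ^ j = 2 * b)
        by (symmetry; apply Z.div_unique_pos with (x - 2 ^ j * (2 * b)); lia).
      assert (2 * b + 1 <= N / 2 ^ j) by (apply Z.div_le_lower_bound; lia).
      rewrite Hd. destruct (Z.ltb_spec (2 * b) (N / 2 ^ j)); lia.
  Qed.
End Target.

(* [Q] is the function of prefix sums of an array indexed from 0. *)
Definition node (Q : Z -> Z) (q : Z) : Z :=
  if q =? 0 then Q 0 else Q q - Q (parent q).

(** The start is a parameter because word [a] of the accumulator holds the window that starts at
    [a]. *)
Fixpoint sum_from (f : Z -> Z) (a : Z) (n : nat) : Z :=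
  match n with O => 0 | S n' => f a + sum_from f (a + 1) n' end.

Lemma sum_from_app (f : Z -> Z) (a : Z) (n m : nat) :
  sum_from f a (n + m) = sum_from f a n + sum_from f (a + Z.of_nat n) m.
Proof.
  revert a. induction n as [|n IH]; intros a.
  - cbn. f_equal. lia.
  - cbn [Nat.add sum_from]. rewrite IH.
    replace (a + Z.of_nat (S n)) with (a + 1 + Z.of_nat n) by lia. lia.
Qed.

Lemma to_word_add (w a b : Z) : to_word w (to_word w a + b) = to_word w (a + b).
Proof. apply Zplus_mod_idemp_l. Qed.

Lemma to_word_add_r (w a b : Z) :
  to_word w (a + to_word w b) = to_word w (a + b).
Proof. apply Zplus_mod_idemp_r. Qed.

(** Telescoping: a set bit [j] contributes [Q (down j x) - Q (down (j + 1) x)], and at an unset bit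
    these two terms coincide. Once [x < 2 ^ n], the last term is [Q 0], which cell 0 supplies. *)
Lemma sum_nodes (w : Z) (Q v : Z -> Z) (x : Z) (n : nat) :
  0 <= x ->
  (forall j, 0 <= j ->
    v j = if Z.testbit x j then to_word w (node Q (down j x)) else 0) ->
  to_word w (sum_from v 0 n) = to_word w (Q x - Q (down (Z.of_nat n) x)).
Proof.
  intros Hx Hv. induction n as [|n IH].
  - change (Z.of_nat 0) with 0. rewrite down_0, Z.sub_diag. easy.
  - rewrite <- Nat.add_1_r, sum_from_app. cbn [sum_from].
    rewrite Z.add_0_l, Z.add_0_r, <- to_word_add, IH, to_word_add.
    rewrite Hv by lia. rewrite Nat2Z.inj_add. change (Z.of_nat 1) with 1.
    destruct (Z.testbit x (Z.of_nat n)) eqn:Eb.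
    + rewrite to_word_add_r. f_equal. unfold node.
      rewrite parent_down by (lia || easy).
      pose proof (down_step (Z.of_nat n) x ltac:(lia)) as E. rewrite Eb in E.
      pose proof (down_nonneg (Z.of_nat n + 1) x).
      destruct (Z.eqb_spec (down (Z.of_nat n) x) 0); lia.
    + pose proof (down_step (Z.of_nat n) x ltac:(lia)) as E. rewrite Eb in E.
      f_equal. rewrite E. rewrite !Z.add_0_r. reflexivity.
Qed.


(** * Memory *)

Definition cell (m : list Z) (q : Z) : Z := nth (Z.to_nat q) m 0.

Definition size (m : list Z) : Z := Z.of_nat (length m).

Lemma read_cell_at (base : Z) (m : list Z) (q : Z) :
  0 <= q < size m -> read_cell base m (base + q) = Some (cell m q).
Proof.
  unfold size. intros Hq. unfold read_cell.
  destruct (Z.leb_spec base (base + q)); [|lia].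
  replace (base + q - base) with q by lia. unfold cell.
  rewrite nth_error_nth' with (d := 0) by lia. easy.
Qed.

Lemma set_nth_at (m : list Z) (i : nat) (v : Z) :
  (i < length m)%nat ->
  exists m', set_nth m i v = Some m' /\ length m' = length m /\
    forall k, nth k m' 0 = if Nat.eqb k i then v else nth k m 0.
Proof.
  revert i. induction m as [|x m IH]; intros [|i] Hi; cbn in Hi; try lia.
  - exists (v :: m). repeat split. now intros [|k].
  - destruct (IH i ltac:(lia)) as (m' & E & El & En).
    exists (x :: m'). cbn. rewrite E, El. repeat split.
    now intros [|k]; cbn.
Qed.

Lemma write_cell_at (base : Z) (m : list Z) (q v : Z) :
  0 <= q < size m ->
  exists m', write_cell base m (base + q) v = Some m' /\ size m' = size m /\
    forall p, 0 <= p -> cell m' p = if p =? q then v else cell m p.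
Proof.
  unfold size. intros Hq. unfold write_cell.
  destruct (Z.leb_spec base (base + q)); [|lia].
  replace (base + q - base) with q by lia.
  destruct (set_nth_at m (Z.to_nat q) v ltac:(lia)) as (m' & E & El & En).
  exists m'. rewrite E, El. repeat split. intros p Hp. unfold cell.
  rewrite En. destruct (Nat.eqb_spec (Z.to_nat p) (Z.to_nat q)),
    (Z.eqb_spec p q); lia || easy.
Qed.

Lemma read_cell_first (base x : Z) (m : list Z) :
  read_cell base (x :: m) base = Some x.
Proof. unfold read_cell. now rewrite Z.leb_refl, Z.sub_diag. Qed.

Lemma write_cell_first (base x v : Z) (m : list Z) :
  write_cell base (x :: m) base v = Some (v :: m).
Proof. unfold write_cell. now rewrite Z.leb_refl, Z.sub_diag. Qed.

Lemma read_cells_map (base : Z) (m : list Z) (f : Z -> Z) (l : list Z) :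
  (forall j, In j l -> 0 <= f j < size m) ->
  read_cells base m (map (fun j => base + f j) l) =
  Some (map (fun j => cell m (f j)) l).
Proof.
  induction l as [|j l IH]; intros H; [easy|]. cbn.
  rewrite read_cell_at, IH; cbn; auto with datatypes.
Qed.

Lemma gather_pack (w base : Z) (m : list Z) (f : Z -> Z) :
  0 <= w -> 0 <= base -> base + size m <= 2 ^ w ->
  (forall j, 0 <= j < w -> 0 <= f j < size m) ->
  read_cells base m (words_of w (pack w (fun j => base + f j))) =
  Some (map (fun j => cell m (f j)) (slots w)).
Proof.
  intros Hw Hb Hm Hf. rewrite words_of_pack; [|easy|].
  - apply read_cells_map. intros j Hj%in_slots. auto.
  - intros j Hj. specialize (Hf j Hj). lia.
Qed.

Lemma gather_first (w base x : Z) (m : list Z) :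
  0 <= w -> 0 <= base < 2 ^ w ->
  read_cells base (x :: m) (words_of w (pack w (fun _ => base))) =
  Some (map (fun _ => x) (slots w)).
Proof.
  intros Hw Hb. rewrite words_of_pack; [|easy|now intros j Hj].
  induction (slots w) as [|j l IH]; [easy|]. cbn.
  now rewrite read_cell_first, IH.
Qed.

(** The values have the form [h (f j)], so they depend on the cell alone: repeated writes to a cell
    agree and their order is immaterial. *)
Lemma write_cells_map (base : Z) (m : list Z) (f h : Z -> Z) (l : list Z) :
  (forall j, In j l -> 0 <= f j < size m) ->
  exists m',
    write_cells base m (map (fun j => (base + f j, h (f j))) l) = Some m' /\
    size m' = size m /\
    forall q, 0 <= q ->
      cell m' q = if existsb (fun j => f j =? q) l then h q else cell m q.
Proof.
  revert m. induction l as [|j l IH]; intros m H.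
  - exists m. repeat split.
  - destruct (write_cell_at base m (f j) (h (f j))) as (m1 & E1 & El1 & Ec1);
      [auto with datatypes|].
    destruct (IH m1) as (m2 & E2 & El2 & Ec2).
    { intros. rewrite El1. auto with datatypes. }
    exists m2. cbn. rewrite E1. cbn. repeat split; [easy|congruence|].
    intros q Hq. rewrite Ec2, Ec1 by easy.
    rewrite (Z.eqb_sym q). destruct (Z.eqb_spec (f j) q) as [<-|]; cbn.
    + now destruct (existsb _ l).
    + easy.
Qed.

Lemma combine_map {X Y Z : Type} (f : X -> Y) (g : X -> Z) (l : list X) :
  combine (map f l) (map g l) = map (fun x => (f x, g x)) l.
Proof. induction l; cbn; congruence. Qed.

Lemma scatter_pack (w base : Z) (m : list Z) (f h : Z -> Z) :
  0 <= w -> 0 <= base -> base + size m <= 2 ^ w ->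
  (forall j, 0 <= j < w -> 0 <= f j < size m) ->
  words_in w (fun j => h (f j)) ->
  exists m',
    scatter base m
      (combine (words_of w (pack w (fun j => base + f j)))
        (words_of w (pack w (fun j => h (f j))))) = Some m' /\
    size m' = size m /\
    forall q, 0 <= q ->
      cell m' q =
      if existsb (fun j => f j =? q) (slots w) then h q else cell m q.
Proof.
  intros Hw Hb Hm Hf Hh. rewrite !words_of_pack; [|easy..|].
  - rewrite combine_map. unfold scatter.
    replace (conflict_free _) with true.
    + apply write_cells_map. intros j Hj%in_slots. auto.
    + symmetry. apply forallb_forall. intros p (j & <- & Hj)%in_map_iff.
      apply forallb_forall. intros q (k & <- & Hk)%in_map_iff. cbn.
      destruct (Z.eqb_spec (base + f j) (base + f k)) as [E|]; [|easy].
      replace (f k) with (f j) by lia. now rewrite Z.eqb_refl.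
  - intros j Hj. specialize (Hf j Hj). lia.
Qed.

(** * The programs *)

(** Execution of a block regardless of its place in a program, so that one analysis of [update_code]
    serves both [update_program] and [build_program]. *)
Fixpoint exec_list (w base : Z) (l : list instr) (s : state) : option state :=
  match l with
  | [] => Some s
  | i :: l' => s' <- exec_instr w base i s ;; exec_list w base l' s'
  end.

Lemma exec_cons (w base : Z) (i : instr) (l : list instr) (s s' : state) :
  exec_instr w base i s = Some s' ->
  exec_list w base (i :: l) s = exec_list w base l s'.
Proof. intros H. cbn [exec_list]. now rewrite H. Qed.

Definition straight (i : instr) : bool :=
  match i with
  | Jump _ | JumpEq _ _ _ | JumpLt _ _ _ | Halt => false
  | _ => true
  end.

Lemma bind_some {X Y : Type} (o : option X) (f : X -> option Y) (y : Y) :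
  bind o f = Some y -> exists x, o = Some x /\ f x = Some y.
Proof. destruct o as [x|]; [|easy]. intros. now exists x. Qed.

Lemma exec_straight_pc (w base : Z) (i : instr) (s s' : state) :
  straight i = true -> exec_instr w base i s = Some s' -> pc s' = S (pc s).
Proof.
  intros Hi He. destruct i; try discriminate Hi; cbn in He;
    unfold next_setw, next_setu, next_setm in He;
    repeat (apply bind_some in He as (? & _ & He)); now injection He as <-.
Qed.

(** Straight-line instructions advance the program counter by one, so a block found at [pc s] is
    fetched in order. At concrete positions the first two hypotheses hold by computation. *)
Lemma run_block (w base : Z) (p l : program) (t : nat) (s s1 s2 : state) :
  firstn (length l) (skipn (pc s) p) = l -> forallb straight l = true ->
  exec_list w base l s = Some s1 ->
  run w base p t s1 s2 -> run w base p (length l + t) s s2.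
Proof.
  intros Hp. pose proof (firstn_skipn (length l) (skipn (pc s) p)) as Hq.
  rewrite Hp in Hq. symmetry in Hq. clear Hp.
  revert Hq. generalize (skipn (length l) (skipn (pc s) p)) as q.
  intros q. revert s. induction l as [|i l IH]; intros s Hp Hl He Hr.
  - now injection He as ->.
  - apply andb_prop in Hl as [Hi Hl]. cbn [exec_list] in He.
    apply bind_some in He as (s' & Hs & He).
    assert (Hn : skipn (S (pc s)) p = l ++ q).
    { replace (S (pc s)) with (1 + pc s)%nat by lia.
      now rewrite <- skipn_skipn, Hp. }
    apply run_step with i s'; [|easy|].
    + rewrite <- (Nat.add_0_r (pc s)), <- nth_error_skipn, Hp. easy.
    + apply IH; try easy. now rewrite (exec_straight_pc w base i s s').
Qed.

Definition nonzero_mask_code : program :=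
  [UOp UAnd 10 9 5; UOp UAdd 10 10 5; UOp UOr 10 10 9; UOp UAnd 10 10 4;
   UShr 9 10 4; UOp USub 9 10 9; UOp UAdd 9 9 10].

Definition wordwise_add_code : program :=
  [UOp UXor 9 12 11; UOp UAnd 9 9 4; UOp UAnd 12 12 5; UOp UAnd 11 11 5;
   UOp UAdd 12 12 11; UOp UXor 12 12 9].

(* The cell [base] serves as a scratch cell: a word is copied to all words of
   an ultraword by writing it there and reading that cell [w] times. *)
Definition update_code : program :=
  [WOp WSub 7 0 5; WOp WSub 7 7 5; WLoad 8 3;
   WStore 3 7; Gather 8 0; WStore 3 1; Gather 11 0; WStore 3 8;
   UOp UAnd 9 8 2; UOp UXor 9 9 6]
  ++ nonzero_mask_code ++
  [UOp UAnd 9 9 3; UOp UOr 8 8 9; UOp UAdd 8 8 7; UOp UAdd 8 0 8; Gather 12 8]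
  ++ wordwise_add_code ++ [Scatter 8 12].

Definition sum_init_code : program :=
  [WOp WSub 0 0 5; WLoad 7 3; WStore 3 0; Gather 8 0; WStore 3 7;
   UOp UAnd 9 8 1]
  ++ nonzero_mask_code ++
  [UOp UAnd 8 8 2; UOp UAdd 8 0 8; Gather 12 8; UOp UAnd 12 12 9; WConst 8 1].

Definition sum_step_code : program :=
  [WOp WMul 1 2 8; UShr 11 12 1] ++ wordwise_add_code ++ [WOp WAdd 8 8 8].

(** Position 18 is the loop test and 30 the exit. The test shifts the queried position, in word
    register 0, by the window length in register 8, so the number of rounds depends on that position
    and not on [w]. *)
Definition sum_program : program :=
  sum_init_code ++
  [WOp WShr 1 0 8; JumpEq 1 6 30] ++ sum_step_code ++ [Jump 18] ++
  [UtoW 0 12; WOp WAdd 0 0 7; Halt].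

(** Position 31 treats [i = 1]: the first entry is counted in cell 0 only, so word operations
    suffice. *)
Definition update_program : program :=
  [JumpEq 0 5 31] ++ update_code ++ [Halt] ++
  [WLoad 7 3; WOp WAdd 7 7 1; WStore 3 7; Halt].


(** * Register contents and symbolic execution *)

(** Arguments of calls overwrite at most registers 0 and 1, so the constants sit in registers 2 to
    6; 7 and 8 are temporary. *)
Definition wfile (w base x0 x1 x7 x8 : Z) : list Z :=
  [x0; x1; w; base; w - 1; 1; 0; x7; x8; 0; 0; 0; 0; 0; 0; 0].

Definition ufile (w base N a b c d e : Z) : list Z :=
  [pack w (fun _ => base); pack w (fun j => 2 ^ j);
   pack w (fun j => 2 ^ w - 2 ^ j); pack w (fun j => 2 ^ j - 1);
   pack w (high w); pack w (low w); pack w (fun j => down j N);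
   pack w (fun _ => 1); a; b; c; d; e].

Ltac exec :=
  cbn [exec_instr getw getu next_setw next_setu next_setm bind
       nth_error set_nth option_map wregs uregs mem pc wfile ufile].

Ltac step :=
  erewrite exec_cons by
    (exec;
     repeat (first [rewrite read_cell_first | rewrite write_cell_first
                   | rewrite gather_first by lia
                   | rewrite gather_pack by (lia || easy)];
             exec);
     reflexivity).

Lemma exec_nonzero_mask (w base N : Z) (l : program) (pc : nat)
    (x0 x1 x7 x8 a b c d e : Z) (m : list Z) :
  exec_list w base (nonzero_mask_code ++ l)
    (State pc (wfile w base x0 x1 x7 x8) (ufile w base N a b c d e) m) =
  exec_list w base l
    (State (7 + pc) (wfile w base x0 x1 x7 x8)
      (ufile w base N a (nonzero_mask w b) (nonzero_flags w b) d e) m).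
Proof.
  unfold nonzero_mask_code. cbn [app]. do 7 step.
  unfold nonzero_mask, nonzero_flags. cbv zeta. reflexivity.
Qed.

Lemma exec_wordwise_add (w base N : Z) (l : program) (pc : nat)
    (x0 x1 x7 x8 a b c d e : Z) (m : list Z) :
  exists b' d',
  exec_list w base (wordwise_add_code ++ l)
    (State pc (wfile w base x0 x1 x7 x8) (ufile w base N a b c d e) m) =
  exec_list w base l
    (State (6 + pc) (wfile w base x0 x1 x7 x8)
      (ufile w base N a b' c d' (wordwise_add w e d)) m).
Proof.
  do 2 eexists. unfold wordwise_add_code. cbn [app]. do 6 step. reflexivity.
Qed.

Lemma words_in_const (w x : Z) : 0 <= x < 2 ^ w -> words_in w (fun _ => x).
Proof. now intros H j Hj. Qed.

Lemma words_in_pow (w : Z) : words_in w (fun j => 2 ^ j).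
Proof. intros j Hj. pose proof (Z.pow_lt_mono_r 2 j w). lia. Qed.

Lemma words_in_upper (w : Z) : words_in w (fun j => 2 ^ w - 2 ^ j).
Proof. intros j Hj. pose proof (Z.pow_lt_mono_r 2 j w). lia. Qed.

Lemma words_in_lower (w : Z) : words_in w (fun j => 2 ^ j - 1).
Proof. intros j Hj. pose proof (Z.pow_lt_mono_r 2 j w). lia. Qed.

Lemma words_in_down (w x : Z) :
  0 <= x < 2 ^ w -> words_in w (fun j => down j x).
Proof.
  intros H j Hj. pose proof (down_nonneg j x). pose proof (down_le j x). lia.
Qed.

Lemma words_in_land (w : Z) (f g : Z -> Z) :
  0 <= w -> words_in w f -> words_in w g ->
  words_in w (fun j => Z.land (f j) (g j)).
Proof. intros Hw Hf Hg j Hj. apply land_range; auto. Qed.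

Lemma words_in_lxor (w : Z) (f g : Z -> Z) :
  0 <= w -> words_in w f -> words_in w g ->
  words_in w (fun j => Z.lxor (f j) (g j)).
Proof. intros Hw Hf Hg j Hj. apply lxor_range; auto. Qed.

Lemma words_in_lor (w : Z) (f g : Z -> Z) :
  0 <= w -> words_in w f -> words_in w g ->
  words_in w (fun j => Z.lor (f j) (g j)).
Proof. intros Hw Hf Hg j Hj. apply lor_range; auto. Qed.

Lemma words_in_mask (w : Z) (f : Z -> Z) :
  0 <= w -> words_in w (fun j => if f j =? 0 then 0 else 2 ^ w - 1).
Proof. intros Hw j Hj. destruct (f j =? 0); lia. Qed.

#[local] Hint Resolve words_in_const words_in_pow words_in_upper words_in_lower
  words_in_down words_in_land words_in_lxor words_in_lor words_in_mask
  : words_in.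

Lemma to_word_small (w x : Z) : 0 <= x < 2 ^ w -> to_word w x = x.
Proof. apply Z.mod_small. Qed.

Lemma to_word_range (w x : Z) : 0 <= w -> 0 <= to_word w x < 2 ^ w.
Proof. intros. apply Z.mod_pos_bound. lia. Qed.

(** An argument [2 ^ w] arrives as 0; subtracting 1 wraps it to [2 ^ w - 1], the intended
    position. *)
Lemma word_pred (w x : Z) :
  eval_word_op w WSub (to_word w x) 1 = to_word w (x - 1).
Proof. apply Zminus_mod_idemp_l. Qed.

(** * Effect of an update and of the start of a sum query *)

Section Memory_fits.
  Variables (w base : Z) (m : list Z).
  Hypotheses (Hw : 1 <= w) (Hbase : 0 <= base).
  Hypothesis Hsize : base + size m <= 2 ^ w.
  Hypothesis Hm : forall q, 0 <= q < size m -> 0 <= cell m q < 2 ^ w.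

  Lemma exec_update (pc : nat) (i d x7 x8 a b c e f : Z) :
    2 <= i <= size m -> 0 <= d < 2 ^ w ->
    exists x7' x8' a' b' c' e' f' m',
    exec_list w base update_code
      (State pc (wfile w base (to_word w i) d x7 x8)
        (ufile w base (size m - 1) a b c e f) m) =
    Some (State (29 + pc) (wfile w base (to_word w i) d x7' x8')
      (ufile w base (size m - 1) a' b' c' e' f') m') /\
    size m' = size m /\
    forall q, 0 <= q < size m ->
      cell m' q =
      if (1 <=? q) && (parent q <=? i - 2) && (i - 2 <? q)
      then to_word w (cell m q + d) else cell m q.
  Proof.
    intros Hi Hd.
    (* The first cell is the scratch cell; naming its contents lets its overwriting and restoring be
       computed. *)
    assert (Em : exists x m', m = x :: m').
    { destruct m as [|x m']; [cbn in Hi; lia|]. now exists x, m'. }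
    destruct Em as (x & m' & Em).
    assert (Es : forall p r u, State p r u m = State p r u (x :: m'))
      by (intros; now rewrite Em).
    rewrite Es. unfold update_code. cbn [app]. do 2 step.
    rewrite !word_pred, (to_word_small w (i - 1 - 1)) by lia.
    do 6 step. rewrite <- Es. do 2 step.
    replace (i - 1 - 1) with (i - 2) by lia.
    (* The entry to change is at position [i - 1 = y + 1], and [N] is the last position, as in
       [target]. *)
    set (N := size m - 1). set (y := i - 2).
    assert (HN : N < 2 ^ w) by lia. assert (Hy : 0 <= y < N) by lia.
    change (ultra_of w (map ?f (slots w))) with (pack w f).
    fold (wfile w base (to_word w i) d y x).
    rewrite uand_pack, uxor_pack by (auto with words_in zarith).
    fold (ufile w base N (pack w (fun _ => y))
      (pack w (fun j => Z.lxor (Z.land y (2 ^ w - 2 ^ j)) (down j N)))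
      c (pack w (fun _ => d)) f).
    rewrite exec_nonzero_mask, nonzero_mask_pack
      by (auto 7 with words_in zarith).
    do 4 step.
    rewrite uand_pack, uor_pack by (auto 7 with words_in zarith).
    assert (Ht : forall j, 0 <= j < w -> 0 <= target w N y j < size m).
    { intros j Hj. pose proof (target_range w N y ltac:(lia) HN Hy j Hj). lia. }
    rewrite uadd_pack;
      [|lia|intros j Hj; specialize (Ht j Hj); unfold target in Ht; lia].
    change (pack w (fun j => Z.lor _ _ + 1)) with (pack w (target w N y)).
    rewrite uadd_pack; [|lia|intros j Hj; specialize (Ht j Hj); lia].
    step.
    change (ultra_of w (map ?f (slots w))) with (pack w f).
    fold (wfile w base (to_word w i) d y x).
    match goal with |- context [State _ _
      (_ :: _ :: _ :: _ :: _ :: _ :: _ :: _ :: ?a :: ?b :: ?c :: ?d :: ?e :: [])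
      _] => fold (ufile w base N a b c d e);
        edestruct (exec_wordwise_add w base N [Scatter 8 12]) as (b0 & d0 & E)
    end.
    rewrite E. clear E.
    rewrite wordwise_add_pack by
      (lia || (intros j Hj; auto)).
    edestruct (scatter_pack w base m (target w N y)
      (fun q => to_word w (cell m q + d))) as (m2 & E2 & El & Ec); try easy.
    { lia. }
    { intros j Hj. apply to_word_range. lia. }
    erewrite exec_cons by (exec; rewrite E2; exec; reflexivity).
    do 8 eexists. split; [reflexivity|]. split; [easy|].
    intros q Hq. rewrite Ec by lia.
    (* By [target_iff], the cells hit by the scattered write are those whose range contains position
       [i - 1]. *)
    replace (existsb _ _)
      with ((1 <=? q) && (parent q <=? y) && (y <? q)); [easy|].
    apply eq_true_iff_eq.
    rewrite existsb_exists, !andb_true_iff, !Z.leb_le, Z.ltb_lt. split.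
    - intros [[H1 H2] H3].
      destruct (proj2 (target_iff w N y ltac:(lia) HN Hy q ltac:(lia)))
        as (j & Hj & Ej); [easy|].
      exists j. now rewrite in_slots, Z.eqb_eq.
    - intros (j & Hj%in_slots & Ej%Z.eqb_eq).
      pose proof (target_range w N y ltac:(lia) HN Hy j Hj).
      split; [split; [lia|]|];
        apply (target_iff w N y ltac:(lia) HN Hy q ltac:(lia)); eauto.
  Qed.

  Lemma exec_sum_init (pc : nat) (i x1 x7 x8 a b c d e : Z) :
    1 <= i <= size m ->
    exists a' b' c',
    exec_list w base sum_init_code
      (State pc (wfile w base (to_word w i) x1 x7 x8)
        (ufile w base (size m - 1) a b c d e) m) =
    Some (State (18 + pc) (wfile w base (i - 1) x1 (cell m 0) 1)
      (ufile w base (size m - 1) a' b' c' d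
        (pack w (fun j =>
          if Z.testbit (i - 1) j then cell m (down j (i - 1)) else 0))) m).
  Proof.
    intros Hi.
    assert (Em : exists x m', m = x :: m').
    { destruct m as [|x m']; [cbn in Hi; lia|]. now exists x, m'. }
    destruct Em as (x & m' & Em).
    assert (Es : forall p r u, State p r u m = State p r u (x :: m'))
      by (intros; now rewrite Em).
    replace (cell m 0) with x by now rewrite Em.
    rewrite Es. unfold sum_init_code. cbn [app]. step.
    rewrite !word_pred, (to_word_small w (i - 1)) by lia.
    do 4 step. rewrite <- Es. step.
    set (N := size m - 1). set (y := i - 1).
    assert (Hy : 0 <= y <= N) by lia. assert (HN : N < 2 ^ w) by lia.
    change (ultra_of w (map ?f (slots w))) with (pack w f).
    rewrite uand_pack by (auto with words_in zarith).
    fold (wfile w base y x1 x x8).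
    fold (ufile w base N (pack w (fun _ => y))
      (pack w (fun j => Z.land y (2 ^ j))) c d e).
    rewrite exec_nonzero_mask, nonzero_mask_pack
      by (auto 7 with words_in zarith).
    do 2 step.
    assert (Ha : forall j, 0 <= j < w -> 0 <= down j y < size m).
    { intros j Hj. pose proof (down_le j y).
      pose proof (down_nonneg j y). lia. }
    rewrite uand_pack by (auto with words_in zarith).
    rewrite (pack_ext w (fun j => Z.land _ _) (fun j => down j y))
      by (intros; apply land_upper; lia).
    rewrite uadd_pack; [|lia|intros j Hj; specialize (Ha j Hj); lia].
    do 3 step. rewrite (to_word_small w 1)
      by (pose proof (Z.pow_le_mono_r 2 1 w); lia).
    change (ultra_of w (map ?f (slots w))) with (pack w f).
    assert (Hc : words_in w (fun j => cell m (down j y)))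
      by (intros j Hj; auto).
    rewrite uand_pack by (auto with words_in zarith).
    (* At an unset bit [j] the cell is the same as for [j + 1]; the mask clears this word, lest a
       cell be counted repeatedly. *)
    rewrite (pack_ext w
      (fun j => Z.land _ (if Z.land y (2 ^ j) =? 0 then 0 else 2 ^ w - 1))
      (fun j => if Z.testbit y j then cell m (down j y) else 0)).
    - do 3 eexists. reflexivity.
    - intros j Hj. rewrite land_pow2 by lia. destruct (Z.testbit y j).
      + destruct (Z.eqb_spec (2 ^ j) 0); [lia|].
        rewrite land_low, Z.mod_small by auto with zarith. easy.
      + apply Z.land_0_r.
  Qed.
End Memory_fits.

(** * Summation in doubling rounds *)

(** Makes the shift distance [w * n] of a round, where [n < w], fit in a word. The factor [w - 1]
    matters: [w * w] exceeds [2 ^ w] for [w = 3]. *)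
Lemma mul_pred_lt_pow (n : nat) :
  Z.of_nat n * (Z.of_nat n - 1) < 2 ^ Z.of_nat n.
Proof.
  enough (forall k : nat,
    (Z.of_nat k + 4) * (Z.of_nat k + 3) < 2 ^ (Z.of_nat k + 4)) as H.
  { destruct n as [|[|[|[|k]]]]; [easy..|].
    specialize (H k). rewrite !Nat2Z.inj_succ. unfold Z.succ.
    replace (Z.of_nat k + 1 + 1 + 1 + 1) with (Z.of_nat k + 4) by lia. lia. }
  induction k as [|k IH]; [easy|].
  replace (Z.of_nat (S k) + 4) with (Z.of_nat k + 4 + 1) by lia.
  rewrite Z.pow_add_r by lia. lia.
Qed.

Lemma exec_sum_step (w base N : Z) (pc n : nat) (x0 x1 x7 a b c d : Z)
    (f : Z -> Z) (m : list Z) :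
  (0 < n)%nat -> Z.of_nat n < w -> words_in w f ->
  (forall j, w <= j -> f j = 0) ->
  exists b' d',
  exec_list w base sum_step_code
    (State pc (wfile w base x0 x1 x7 (Z.of_nat n))
      (ufile w base N a b c d (pack w f)) m) =
  Some (State (9 + pc)
    (wfile w base x0 (w * Z.of_nat n) x7 (Z.of_nat (2 * n)))
    (ufile w base N a b' c d'
      (pack w (fun j => to_word w (f j + f (j + Z.of_nat n))))) m).
Proof.
  intros Hn Hw Hf H0. pose proof (mul_pred_lt_pow (Z.to_nat w)) as Hp.
  rewrite Z2Nat.id in Hp by lia.
  assert (Hg : words_in w (fun j => f (j + Z.of_nat n))).
  { intros j Hj. destruct (Z.ltb_spec (j + Z.of_nat n) w).
    - apply Hf. lia.
    - rewrite H0; lia. }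
  unfold sum_step_code. cbn [app]. step.
  unfold eval_word_op. rewrite to_word_small by nia. step.
  rewrite shiftr_pack by (lia || easy). rewrite to_ultra_pack by (lia || easy).
  fold (wfile w base x0 (w * Z.of_nat n) x7 (Z.of_nat n)).
  fold (ufile w base N a b c (pack w (fun j => f (j + Z.of_nat n))) (pack w f)).
  edestruct (exec_wordwise_add w base N [WOp WAdd 8 8 8]) as (b' & d' & E).
  rewrite E. clear E. rewrite wordwise_add_pack by (lia || easy). step.
  unfold eval_word_op. rewrite to_word_small by nia.
  replace (Z.of_nat n + Z.of_nat n) with (Z.of_nat (2 * n)) by lia.
  do 2 eexists. reflexivity.
Qed.

(** Fixes only what persists between calls, the constants and the memory; program counter and
    working registers are left open. *)
Definition machine (w base N : Z) (m : list Z) (s : state) : Prop :=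
  exists pc x0 x1 x7 x8 a b c d e,
    s = State pc (wfile w base x0 x1 x7 x8) (ufile w base N a b c d e) m.

Definition represents (w : Z) (Q : Z -> Z) (m : list Z) : Prop :=
  forall q, 0 <= q < size m -> cell m q = to_word w (node Q q).

Lemma sum_from_zero (f : Z -> Z) (a : Z) (n : nat) :
  (forall j, a <= j -> f j = 0) -> sum_from f a n = 0.
Proof.
  revert a. induction n as [|n IH]; intros a H; [easy|].
  cbn [sum_from]. rewrite H, IH by (lia || (intros; apply H; lia)). lia.
Qed.

Lemma pack_first (w : Z) (f : Z -> Z) :
  1 <= w -> words_in w f -> to_word w (pack w f) = f 0.
Proof.
  intros Hw Hf.
  pose proof (ultra_of_word w _ 0 ltac:(lia) (words_in_slots w f Hf)) as E.
  rewrite Z.mul_0_r, Z.div_1_r in E. unfold to_word, pack. rewrite E.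
  unfold slots. destruct (Z.to_nat w) eqn:En; [lia|easy].
Qed.

Lemma shiftr_word (w x n : Z) :
  0 <= x < 2 ^ w -> 0 <= n -> eval_word_op w WShr x n = x / 2 ^ n.
Proof.
  intros Hx Hn. unfold eval_word_op. rewrite Z.shiftr_div_pow2 by lia.
  apply to_word_small. pose proof (Z.div_pos x (2 ^ n) ltac:(lia) ltac:(lia)).
  pose proof (Z.mul_div_le x (2 ^ n) ltac:(lia)). nia.
Qed.

Section Sum_loop.
  Variables (w base N : Z) (Q v : Z -> Z) (x x7 : Z) (m : list Z).
  Hypotheses (Hw : 1 <= w) (Hx : 0 <= x < 2 ^ w).
  Hypothesis Hv : forall j, 0 <= j ->
    v j = if Z.testbit x j then to_word w (node Q (down j x)) else 0.

  Definition loop_state (n : nat) (x1 a b c d : Z) : state :=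
    State 18 (wfile w base x x1 x7 (Z.of_nat n))
      (ufile w base N a b c d
        (pack w (fun j => to_word w (sum_from v j n)))) m.

  Lemma run_sum_exit (n : nat) (x1 a b c d : Z) :
    x < 2 ^ Z.of_nat n ->
    exists s',
      run w base sum_program 5 (loop_state n x1 a b c d) s' /\
      result s' = to_word w (Q x - Q 0 + x7) /\ machine w base N m s'.
  Proof.
    intros Hn. eexists. split; [|split].
    - eapply run_step; [reflexivity|exec; reflexivity|].
      eapply run_step; [reflexivity|exec|].
      { rewrite shiftr_word, Z.div_small by lia. reflexivity. }
      cbn [Z.eqb goto wregs uregs mem].
      do 2 (eapply run_step; [reflexivity|exec; reflexivity|]).
      apply run_halt. reflexivity.
    - cbn [result wregs nth]. rewrite pack_first;
        [|lia|intros j Hj; apply to_word_range; lia].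
      unfold eval_word_op. rewrite (sum_nodes w Q v x) by (lia || exact Hv).
      now rewrite to_word_add, down_small by lia.
    - repeat eexists; unfold wfile; reflexivity.
  Qed.

  (** [k] bounds the rounds left: a round doubles [n], so [n * 2 ^ k] is kept when [k] decreases. A
      round costs 12 instructions, namely two for the test, nine for the step and one to jump back;
      the exit costs 5. *)
  Lemma run_sum_loop (k n : nat) (x1 a b c d : Z) :
    (0 < n)%nat -> x < 2 ^ (Z.of_nat n * 2 ^ Z.of_nat k) ->
    exists t s',
      run w base sum_program t (loop_state n x1 a b c d) s' /\
      (t <= 12 * k + 5)%nat /\
      result s' = to_word w (Q x - Q 0 + x7) /\ machine w base N m s'.
  Proof.
    revert n x1 b d. induction k as [|k IH]; intros n x1 b d Hn Hk.
    { rewrite Z.pow_0_r, Z.mul_1_r in Hk.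
      destruct (run_sum_exit n x1 a b c d Hk) as (s' & H).
      exists 5%nat, s'. split; [apply H|]. split; [lia|apply H]. }
    destruct (Z.lt_ge_cases x (2 ^ Z.of_nat n)) as [Hlt|Hge].
    { destruct (run_sum_exit n x1 a b c d Hlt) as (s' & H).
      exists 5%nat, s'. split; [apply H|]. split; [lia|apply H]. }
    (* Another round is entered only if [2 ^ n <= x < 2 ^ w], which keeps the shift distance within
       a word. *)
    assert (Hnw : Z.of_nat n < w).
    { apply (Z.pow_lt_mono_r_iff 2); lia. }
    assert (Hv0 : forall j, w <= j -> v j = 0).
    { intros j Hj. rewrite Hv, Z.testbit_eqb, Z.div_small by
        (pose proof (Z.pow_le_mono_r 2 w j); lia). easy. }
    destruct (exec_sum_step w base N 20 n x (x / 2 ^ Z.of_nat n) x7 a b c d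
      (fun j => to_word w (sum_from v j n)) m) as (b' & d' & Es).
    { exact Hn. }
    { exact Hnw. }
    { intros j Hj. apply to_word_range. lia. }
    { intros j Hj. rewrite sum_from_zero; [easy|]. intros; apply Hv0; lia. }
    destruct (IH (2 * n)%nat (w * Z.of_nat n) b' d')
      as (t & s' & Hr & Ht & Hs'); [lia| |].
    { replace (Z.of_nat (2 * n) * 2 ^ Z.of_nat k)
        with (Z.of_nat n * 2 ^ Z.of_nat (S k)); [easy|].
      rewrite Nat2Z.inj_succ, Z.pow_succ_r by lia. lia. }
    exists (2 + (9 + (1 + t)))%nat, s'. split; [|split; [lia|exact Hs']].
    eapply run_step; [reflexivity|exec; reflexivity|].
    eapply run_step; [reflexivity|exec; reflexivity|].
    rewrite shiftr_word by lia.
    destruct (Z.eqb_spec (x / 2 ^ Z.of_nat n) 0) as [E|_].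
    { apply Z.div_small_iff in E; lia. }
    apply (run_block w base sum_program sum_step_code) with (3 := Es);
      [reflexivity..|].
    eapply run_step; [reflexivity|exec; reflexivity|].
    cbn [goto wregs uregs mem]. unfold loop_state in Hr.
    (* Two adjacent windows of length [n] join to one of length [2 * n]. *)
    erewrite pack_ext; [exact Hr|]. intros j Hj. cbn beta.
    rewrite to_word_add, to_word_add_r, <- sum_from_app. do 2 f_equal. lia.
  Qed.
End Sum_loop.

Lemma node_first (Q : Z -> Z) : node Q 0 = Q 0.
Proof. easy. Qed.

(** With [l = log2 (log2 n)] for [n] cells there are at most [l + 1] rounds, hence at most
    [18 + 12 * (l + 1) + 5 = 35 + 12 * l] instructions; this is where 35 comes from. *)
Lemma run_sum (w base i : Z) (Q : Z -> Z) (m : list Z) (s : state) :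
  1 <= w -> 0 <= base -> base + size m <= 2 ^ w -> 1 <= i <= size m ->
  represents w Q m -> machine w base (size m - 1) m s ->
  exists t s',
    run w base sum_program t (call w [i] s) s' /\
    Z.of_nat t <= 35 * (1 + Z.log2 (Z.log2 (size m))) /\
    result s' = to_word w (Q (i - 1)) /\ machine w base (size m - 1) m s'.
Proof.
  intros Hw Hb Hs Hi HQ (pc & x0 & x1 & x7 & x8 & a & b & c & d & e & ->).
  assert (Hm : forall q, 0 <= q < size m -> 0 <= cell m q < 2 ^ w).
  { intros q Hq. rewrite HQ by easy. apply to_word_range. lia. }
  destruct (exec_sum_init w base m Hw Hb Hs Hm 0 i x1 x7 x8 a b c d e Hi)
    as (a' & b' & c' & E).
  set (l := Z.log2 (Z.log2 (size m))).
  assert (Hl : 0 <= l) by apply Z.log2_nonneg.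
  set (x := i - 1) in *.
  (* A window of length 1 doubled [l + 1] times covers all bits of [x], since the logarithm of the
     size is less than [2 ^ (l + 1)]. *)
  assert (Hlog : x < 2 ^ (Z.of_nat 1 * 2 ^ Z.of_nat (Z.to_nat (l + 1)))).
  { rewrite Z2Nat.id, Z.mul_1_l by lia.
    apply Z.lt_le_trans with (size m); [lia|].
    destruct (Z.log2_spec (size m)) as [_ H]; [lia|].
    apply Z.le_trans with (2 ^ Z.succ (Z.log2 (size m))); [lia|].
    apply Z.pow_le_mono_r; [lia|]. apply Z.le_succ_l. fold l.
    destruct (Z.eq_dec (Z.log2 (size m)) 0) as [E0|].
    - rewrite E0. apply Z.pow_pos_nonneg; lia.
    - apply Z.log2_spec. pose proof (Z.log2_nonneg (size m)). lia. }
  set (v := fun j => if Z.testbit x j then cell m (down j x) else 0) in *.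
  assert (Hv : forall j, 0 <= j ->
    v j = if Z.testbit x j then to_word w (node Q (down j x)) else 0).
  { intros j Hj. unfold v. destruct (Z.testbit x j); [|easy].
    apply HQ. pose proof (down_le j x). pose proof (down_nonneg j x). lia. }
  destruct (run_sum_loop w base (size m - 1) Q v x (cell m 0) m Hw ltac:(lia) Hv
    (Z.to_nat (l + 1)) 1 x1 a' b' c' d)
    as (t & s' & Hr & Ht & Hres & Hs'); [lia|exact Hlog|].
  exists (18 + t)%nat, s'. split; [|split; [lia|split; [|easy]]].
  - apply (run_block w base sum_program sum_init_code) with (3 := E);
      [reflexivity..|].
    unfold loop_state in Hr.
    erewrite pack_ext; [exact Hr|]. intros j Hj. cbn [sum_from].
    rewrite Z.add_0_r, to_word_small; [easy|]. unfold v.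
    destruct (Z.testbit x j); [|lia]. apply Hm.
    pose proof (down_le j x). pose proof (down_nonneg j x). lia.
  (* The loop leaves out [Q 0]; the word saved from cell 0 adds it. *)
  - rewrite Hres, HQ by lia. rewrite to_word_add_r, node_first. f_equal. lia.
Qed.

(** * Updates of the tree *)

Lemma cell_cons (x : Z) (m : list Z) (q : Z) :
  0 <= q -> cell (x :: m) q = if q =? 0 then x else cell m (q - 1).
Proof.
  intros Hq. unfold cell. destruct (Z.eqb_spec q 0) as [->|]; [easy|].
  now replace (Z.to_nat q) with (S (Z.to_nat (q - 1))) by lia.
Qed.

Lemma to_word_eq_1 (w i : Z) :
  1 <= w -> 1 <= i <= 2 ^ w -> (to_word w i =? 1) = (i =? 1).
Proof.
  intros Hw Hi. destruct (Z.eq_dec i (2 ^ w)) as [->|].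
  - unfold to_word. rewrite Z_mod_same_full.
    pose proof (Z.pow_le_mono_r 2 1 w). destruct (Z.eqb_spec (2 ^ w) 1); lia.
  - now rewrite to_word_small by lia.
Qed.

Lemma nonempty_cons (m : list Z) : 1 <= size m -> exists x m', m = x :: m'.
Proof. destruct m as [|x m']; [cbn; lia|]. now exists x, m'. Qed.

(** The difference [Q q - Q (parent q)] changes by [d] exactly if [parent q < i - 1 <= q]. For
    [i = 1] both terms change at every [q >= 1], so only cell 0 is affected. *)
Lemma run_update (w base i d : Z) (Q Q' : Z -> Z) (m : list Z) (s : state) :
  1 <= w -> 0 <= base -> base + size m <= 2 ^ w -> 1 <= i <= size m ->
  (forall q, 0 <= q < size m -> Q' q = Q q + if i - 1 <=? q then d else 0) ->
  represents w Q m -> machine w base (size m - 1) m s ->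
  exists t s' m',
    run w base update_program t (call w [i; d] s) s' /\ (t <= 35)%nat /\
    size m' = size m /\ represents w Q' m' /\
    machine w base (size m - 1) m' s'.
Proof.
  intros Hw Hb Hs Hi HQ' HQ (pc & x0 & x1 & x7 & x8 & a & b & c & e & f & ->).
  assert (Hm : forall q, 0 <= q < size m -> 0 <= cell m q < 2 ^ w).
  { intros q Hq. rewrite HQ by easy. apply to_word_range. lia. }
  destruct (Z.eq_dec i 1) as [->|Hi1].
  - destruct (nonempty_cons m) as (x & m' & ->); [lia|].
    do 2 eexists. exists (to_word w (x + to_word w d) :: m').
    split; [|split; [|split; [|split]]].
    + unfold call. cbn [map app skipn length wfile wregs uregs mem].
      eapply run_step; [reflexivity|exec; reflexivity|].
      rewrite to_word_eq_1 by lia. cbn [Z.eqb Pos.eqb]. unfold goto.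
      cbn [wregs uregs mem].
      eapply run_step; [reflexivity|exec|].
      { rewrite read_cell_first. exec. reflexivity. }
      eapply run_step; [reflexivity|exec; reflexivity|].
      eapply run_step; [reflexivity|exec|].
      { rewrite write_cell_first. exec. reflexivity. }
      apply run_halt. reflexivity.
    + lia.
    + easy.
    + intros q Hq. change (size (_ :: m')) with (size (x :: m')) in Hq.
      specialize (HQ q Hq). rewrite cell_cons in HQ |- * by lia.
      unfold node in HQ |- *. destruct (Z.eq_dec q 0) as [E|E].
      * subst q. cbn [Z.eqb] in HQ |- *.
        now rewrite HQ, to_word_add, to_word_add_r, HQ' by lia.
      * rewrite (proj2 (Z.eqb_neq _ _) E) in HQ |- *.
        pose proof (parent_range q ltac:(lia)). rewrite HQ, !HQ' by lia.
        destruct (Z.leb_spec (1 - 1) q), (Z.leb_spec (1 - 1) (parent q));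
          try lia.
        f_equal. lia.
    + repeat eexists; unfold wfile; reflexivity.
  - destruct (exec_update w base m Hw Hb Hs Hm 1 i (to_word w d)
      x7 x8 a b c e f)
      as (x7' & x8' & a' & b' & c' & e' & f' & m' & E & Em & Ec);
      [lia|apply to_word_range; lia|].
    do 2 eexists. exists m'. split; [|split; [|split; [easy|split]]].
    + unfold call. cbn [map app skipn length wfile wregs uregs mem].
      eapply run_step; [reflexivity|exec; reflexivity|].
      rewrite to_word_eq_1 by lia. destruct (Z.eqb_spec i 1); [lia|].
      apply (run_block w base update_program update_code) with (3 := E);
        [reflexivity..|].
      apply run_halt. reflexivity.
    + cbn. lia.
    + intros q Hq. rewrite Em in Hq. specialize (HQ q Hq).
      rewrite Ec, HQ by lia. unfold node. destruct (Z.eqb_spec q 0) as [E0|E0].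
      * subst q. rewrite HQ' by lia. cbn [Z.leb Z.compare andb].
        destruct (Z.leb_spec (i - 1) 0); [lia|]. f_equal. lia.
      * pose proof (parent_range q ltac:(lia)). rewrite !HQ' by lia.
        destruct (Z.leb_spec 1 q), (Z.leb_spec (parent q) (i - 2)),
          (Z.ltb_spec (i - 2) q), (Z.leb_spec (i - 1) q),
          (Z.leb_spec (i - 1) (parent q)); try lia; cbn [andb];
          rewrite ?to_word_add, ?to_word_add_r; f_equal; lia.
    + repeat eexists; unfold wfile; reflexivity.
Qed.

(** * Construction of the constants *)

(** Adding register 6, which is 0, serves as a copy. The size goes to register 0, where the loop
    over the entries counts down. *)
Definition constants_code : program :=
  [WOp WAdd 3 0 6; WConst 5 1; WOp WSub 4 2 5; WOp WAdd 0 1 6;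
   WtoU 8 5; WtoU 9 3].

(* Each round shifts [1], [base] and the powers of two into registers 7, 0 and
   1 by one word; the powers of two move by one bit more. *)
Definition horner_code : program :=
  [UShl 0 0 2; UOp UAdd 0 0 9; UShl 7 7 2; UOp UAdd 7 7 8;
   UShl 1 1 2; UShl 1 1 5; UOp UAdd 1 1 8; WOp WAdd 7 7 5].

(** Top bit plus low bits give all ones, from which [2 ^ j - 1] is subtracted to get
    [2 ^ w - 2 ^ j]. No step carries or borrows across words. *)
Definition masks_code : program :=
  [UShl 4 7 4; UOp USub 5 4 7; UOp UAdd 2 4 5; UOp USub 3 1 7; UOp USub 2 2 3;
   WOp WSub 1 1 5; WLoad 7 3; WStore 3 1; Gather 6 0; WStore 3 7;
   UOp UAnd 6 6 2].

(** Moving the entry to register 1 and clearing its cell turns its insertion into an ordinary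
    update. *)
Definition take_code : program :=
  [WOp WAdd 7 3 0; WOp WSub 7 7 5; WLoad 1 7; WStore 7 6].

Definition build_program : program :=
  constants_code ++ horner_code ++ [JumpLt 7 2 6] ++ masks_code ++
  [JumpEq 0 5 62] ++ take_code ++ update_code ++
  [WOp WSub 0 0 5; Jump 26; Halt].

(** Horner's scheme for [x * (1 + q + ... + q ^ (k - 1))]. *)
Definition horner (q x : Z) (k : nat) : Z := Nat.iter k (fun u => q * u + x) 0.

Lemma pack_const_horner (w x : Z) :
  pack w (fun _ => x) = horner (2 ^ w) x (Z.to_nat w).
Proof.
  unfold pack, slots. generalize 0%nat as s.
  induction (Z.to_nat w) as [|n IH]; intros s; [easy|].
  cbn [seq map]. change (horner (2 ^ w) x (S n)) with
    (2 ^ w * horner (2 ^ w) x n + x).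
  rewrite <- (IH (S s)). unfold ultra_of. cbn [fold_right]. lia.
Qed.

(** Word [j] contributes [2 ^ j * 2 ^ (w * j) = (2 ^ (w + 1)) ^ j], the term of a geometric series.
    Slots starting at any [s] are needed for the induction and give the factor [2 ^ s]. *)
Lemma pack_pow_horner (w : Z) :
  0 <= w ->
  pack w (fun j => 2 ^ j) = horner (2 ^ (w + 1)) 1 (Z.to_nat w).
Proof.
  intros Hw. unfold pack, slots.
  enough (forall n s,
    ultra_of w (map (fun j => 2 ^ j) (map Z.of_nat (seq s n))) =
    2 ^ Z.of_nat s * horner (2 ^ (w + 1)) 1 n) as H by (rewrite H; lia).
  induction n as [|n IH]; intros s; [cbn; lia|].
  change (horner (2 ^ (w + 1)) 1 (S n)) with
    (2 ^ (w + 1) * horner (2 ^ (w + 1)) 1 n + 1).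
  cbn [seq map]. unfold ultra_of. cbn [fold_right].
  fold (ultra_of w (map (fun j => 2 ^ j) (map Z.of_nat (seq (S s) n)))).
  rewrite IH, Nat2Z.inj_succ, Z.pow_succ_r, Z.pow_add_r by lia. ring.
Qed.

Lemma to_ultra_shiftl_add (w k u x : Z) :
  0 <= k ->
  eval_ultra_op w UAdd (to_ultra w (Z.shiftl (to_ultra w u) k)) x =
  to_ultra w (2 ^ k * u + x).
Proof.
  intros Hk. unfold eval_ultra_op, to_ultra. rewrite Z.shiftl_mul_pow2 by lia.
  rewrite Zplus_mod_idemp_l, <- Zplus_mod_idemp_l, Zmult_mod_idemp_l,
    Zplus_mod_idemp_l. f_equal. lia.
Qed.

Lemma to_ultra_shiftl (w k u : Z) :
  0 <= k -> to_ultra w (Z.shiftl (to_ultra w u) k) = to_ultra w (2 ^ k * u).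
Proof.
  intros Hk. unfold to_ultra.
  rewrite Z.shiftl_mul_pow2, Zmult_mod_idemp_l by lia.
  f_equal. lia.
Qed.

(** Stating the ultrawords modulo [2 ^ (w * w)] keeps range proofs out of the loop; after the last
    round they are of the form [pack], whose range is known. *)
Definition horner_state (w base x0 x1 : Z) (m : list Z) (pc k : nat) : state :=
  State pc (wfile w base x0 x1 (Z.of_nat k) 0)
    [to_ultra w (horner (2 ^ w) base k);
     to_ultra w (horner (2 ^ (w + 1)) 1 k); 0; 0; 0; 0; 0;
     to_ultra w (horner (2 ^ w) 1 k); 1; base; 0; 0; 0] m.

Lemma exec_horner (w base x0 x1 : Z) (m : list Z) (k : nat) :
  1 <= w -> Z.of_nat k < w ->
  exec_list w base horner_code (horner_state w base x0 x1 m 6 k) =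
  Some (horner_state w base x0 x1 m 14 (S k)).
Proof.
  intros Hw Hk. unfold horner_code, horner_state.
  do 8 step. cbn [exec_list].
  rewrite (to_ultra_shiftl w w (horner (2 ^ (w + 1)) 1 k)) by lia.
  rewrite !to_ultra_shiftl_add by lia.
  rewrite Z.mul_assoc, <- Z.pow_add_r, (Z.add_comm 1) by lia.
  replace (eval_word_op w WAdd (Z.of_nat k) 1) with (Z.of_nat (S k)); [easy|].
  unfold eval_word_op. rewrite Nat2Z.inj_succ, to_word_small; [easy|].
  pose proof (Z.pow_gt_lin_r 2 w). lia.
Qed.

(** The run after the loop is a hypothesis, to which the remaining rounds are prepended. The test
    follows the body, hence [k < w] on entry. *)
Lemma run_horner (w base x0 x1 : Z) (m : list Z) (t k : nat) (s : state) :
  1 <= w -> Z.of_nat k < w ->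
  run w base build_program t
    (horner_state w base x0 x1 m 15 (Z.to_nat w)) s ->
  exists t',
    run w base build_program t' (horner_state w base x0 x1 m 6 k) s.
Proof.
  intros Hw Hk Hr. remember (Z.to_nat w - k)%nat as r eqn:Er.
  revert k Hk Er. induction r as [|r IH]; intros k Hk Er; [lia|].
  assert (Hj : exists t', run w base build_program t'
    (horner_state w base x0 x1 m
      (if Z.of_nat (S k) <? w then 6 else 15) (S k)) s).
  { destruct (Z.ltb_spec (Z.of_nat (S k)) w).
    - apply IH; lia.
    - replace (S k) with (Z.to_nat w) by lia. now exists t. }
  destruct Hj as (t' & Ht'). exists (8 + S t')%nat.
  apply (run_block w base build_program horner_code)
    with (3 := exec_horner w base x0 x1 m k Hw Hk); [reflexivity..|].
  eapply run_step; [reflexivity|reflexivity|exact Ht'].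
Qed.

Lemma horner_state_end (w base x0 x1 : Z) (m : list Z) (pc : nat) :
  1 <= w -> 0 <= base < 2 ^ w ->
  horner_state w base x0 x1 m pc (Z.to_nat w) =
  State pc (wfile w base x0 x1 w 0)
    [pack w (fun _ => base); pack w (fun j => 2 ^ j); 0; 0; 0; 0; 0;
     pack w (fun _ => 1); 1; base; 0; 0; 0] m.
Proof.
  intros Hw Hb. unfold horner_state. rewrite Z2Nat.id by lia.
  rewrite <- !pack_const_horner, <- pack_pow_horner by lia.
  pose proof (Z.pow_le_mono_r 2 1 w).
  rewrite !to_ultra_pack by (lia || (auto with words_in zarith)). easy.
Qed.

Lemma exec_masks (w base x0 : Z) (m : list Z) :
  1 <= w -> 0 <= base -> base + size m <= 2 ^ w -> 1 <= size m ->
  exists x1 x7 a b c d e,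
  exec_list w base masks_code
    (horner_state w base x0 (to_word w (size m)) m 15 (Z.to_nat w)) =
  Some (State 26 (wfile w base x0 x1 x7 0)
    (ufile w base (size m - 1) a b c d e) m).
Proof.
  intros Hw Hb Hs Hm. rewrite horner_state_end by lia.
  destruct (nonempty_cons m Hm) as (x & m' & Em).
  assert (Es : forall p r u, State p r u m = State p r u (x :: m'))
    by (intros; now rewrite Em).
  pose proof (half_word w Hw) as H2.
  assert (Hh : words_in w (high w)) by (apply words_in_const; lia).
  assert (Hl : words_in w (low w)) by (apply words_in_const; lia).
  pose proof (words_in_lower w) as Hlo. pose proof (words_in_upper w) as Hup.
  unfold masks_code. step.
  replace (to_ultra w (Z.shiftl _ _)) with (pack w (high w)).
  2:{ rewrite Z.shiftl_mul_pow2, Z.mul_comm, <- pack_scale by lia.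
      rewrite (pack_ext w (fun _ => 2 ^ (w - 1) * 1) (high w))
        by (intros; unfold high; lia).
      now rewrite to_ultra_pack by (lia || easy). }
  step. rewrite usub_pack; [|lia|intros j Hj; unfold high; lia].
  change (pack w (fun j => high w j - 1)) with (pack w (low w)).
  step. rewrite uadd_pack; [|lia|intros j Hj; unfold high, low; lia].
  step. rewrite usub_pack by (lia || easy).
  step. rewrite usub_pack;
    [|lia|intros j Hj; specialize (Hup j Hj); unfold high, low; lia].
  rewrite (pack_ext w (fun j => high w j + low w j - (2 ^ j - 1))
    (fun j => 2 ^ w - 2 ^ j)) by (intros; unfold high, low; lia).
  step. rewrite word_pred, (to_word_small w (size m - 1)) by lia.
  rewrite Es. do 4 step. rewrite <- Es. step.
  change (ultra_of w (map ?f (slots w))) with (pack w f).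
  rewrite uand_pack by (auto with words_in zarith).
  rewrite (pack_ext w (fun j => Z.land _ _) (fun j => down j (size m - 1)))
    by (intros; apply land_upper; lia).
  do 7 eexists. reflexivity.
Qed.

(** * Insertion of the entries *)

(** An input entry written through prefix sums, so that one [Q] describes both untouched cells and
    tree cells. *)
Definition raw (Q : Z -> Z) (q : Z) : Z :=
  if q =? 0 then Q 0 else Q q - Q (q - 1).

(* The cells from [i] on hold the tree of the array whose first [i] entries
   are replaced by 0; the other cells hold their initial contents. *)
Definition partial (w : Z) (Q : Z -> Z) (i : Z) (m : list Z) : Prop :=
  forall q, 0 <= q < size m ->
    cell m q =
    to_word w (if q <? i then raw Q q else Q q - Q (Z.max (parent q) (i - 1))).

(** In a cell from [i] on with parent at most [i - 2], adding the entry [Q (i - 1) - Q (i - 2)]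
    lowers the start of the sum from [i - 1] to [i - 2]; with a larger parent the maximum is the
    parent and stays. Cell [i - 1] starts from the cleared value 0. *)
Lemma partial_step (w i : Z) (Q : Z -> Z) (m m1 m2 : list Z) :
  0 <= w -> 2 <= i <= size m -> size m1 = size m -> size m2 = size m ->
  (forall q, 0 <= q < size m ->
    cell m1 q = if q =? i - 1 then 0 else cell m q) ->
  (forall q, 0 <= q < size m ->
    cell m2 q =
    if (1 <=? q) && (parent q <=? i - 2) && (i - 2 <? q)
    then to_word w (cell m1 q + cell m (i - 1)) else cell m1 q) ->
  partial w Q i m -> partial w Q (i - 1) m2.
Proof.
  intros Hw Hi E1 E2 H1 H2 HP q Hq. rewrite E2 in Hq.
  rewrite H2, H1, (HP (i - 1)), (HP q) by lia. unfold raw.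
  destruct (Z.ltb_spec (i - 1) i); [|lia].
  destruct (Z.eqb_spec (i - 1) 0); [lia|].
  destruct (Z.eqb_spec q 0) as [E0|E0].
  - subst q. cbn [Z.leb Z.compare andb].
    destruct (Z.eqb_spec 0 (i - 1)); [lia|].
    destruct (Z.ltb_spec 0 i), (Z.ltb_spec 0 (i - 1)); lia || easy.
  - pose proof (parent_range q ltac:(lia)).
    destruct (Z.leb_spec 1 q); [|lia].
    destruct (Z.eqb_spec q (i - 1)) as [Eq|Eq].
    + subst q. destruct (Z.leb_spec (parent (i - 1)) (i - 2)); [|lia].
      destruct (Z.ltb_spec (i - 2) (i - 1)); [|lia].
      destruct (Z.ltb_spec (i - 1) (i - 1)); [lia|].
      cbn [andb]. now rewrite to_word_add_r, Z.add_0_l, Z.max_r by lia.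
    + destruct (Z.ltb_spec q i), (Z.ltb_spec q (i - 1)), (Z.ltb_spec (i - 2) q);
        try lia; rewrite ?andb_false_r, ?andb_true_r; cbn [andb]; [easy|].
      destruct (Z.leb_spec (parent q) (i - 2)).
      * rewrite to_word_add, to_word_add_r. f_equal.
        rewrite !Z.max_r by lia. lia.
      * now rewrite !Z.max_l by lia.
Qed.

Lemma partial_represents (w : Z) (Q : Z -> Z) (m : list Z) :
  partial w Q 1 m -> represents w Q m.
Proof.
  intros HP q Hq. rewrite HP by easy. unfold raw, node.
  destruct (Z.eqb_spec q 0) as [E|E].
  - now subst q.
  - destruct (Z.ltb_spec q 1); [lia|].
    pose proof (parent_range q ltac:(lia)). now rewrite Z.max_l by lia.
Qed.

(** The loop stops at [i = 1] because the first entry already sits in cell 0, where the tree wants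
    it. *)
Lemma run_build_loop (w base : Z) (Q : Z -> Z) (r : nat) (m : list Z)
    (x1 x7 x8 a b c d e : Z) :
  1 <= w -> 0 <= base -> base + size m <= 2 ^ w ->
  Z.of_nat (S r) <= size m -> partial w Q (Z.of_nat (S r)) m ->
  exists t s m',
    run w base build_program t
      (State 26 (wfile w base (to_word w (Z.of_nat (S r))) x1 x7 x8)
        (ufile w base (size m - 1) a b c d e) m) s /\
    size m' = size m /\ represents w Q m' /\
    machine w base (size m - 1) m' s.
Proof.
  intros Hw Hb. revert m x1 x7 x8 a b c d e.
  induction r as [|r IH]; intros m x1 x7 x8 a b c d e Hs Hi HP.
  - do 2 eexists. exists m. split; [|split; [|split]].
    + eapply run_step; [reflexivity|exec; reflexivity|].
      change (Z.of_nat 1) with 1. rewrite to_word_eq_1 by lia.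
      apply run_halt. reflexivity.
    + easy.
    + now apply partial_represents.
    + repeat eexists; unfold wfile; reflexivity.
  - set (i := Z.of_nat (S (S r))) in *.
    assert (Hm : forall q, 0 <= q < size m -> 0 <= cell m q < 2 ^ w).
    { intros q Hq. rewrite HP by easy. apply to_word_range. lia. }
    destruct (write_cell_at base m (i - 1) 0 ltac:(lia)) as (m1 & W & E1 & H1).
    assert (Hm1 : forall q, 0 <= q < size m1 -> 0 <= cell m1 q < 2 ^ w).
    { intros q Hq. rewrite H1 by lia. destruct (q =? i - 1); [lia|].
      apply Hm. lia. }
    destruct (exec_update w base m1 Hw Hb ltac:(lia) Hm1 31 i (cell m (i - 1))
      (base + (i - 1)) x8 a b c d e)
      as (x7' & x8' & a' & b' & c' & d' & e' & m2 & E & E2 & H2);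
      [lia|apply Hm; lia|].
    rewrite E1 in *.
    destruct (IH m2 (cell m (i - 1)) x7' x8' a' b' c' d' e')
      as (t & s & m' & Hr & Es & HQ & Hk); [lia|lia| |].
    { replace (Z.of_nat (S r)) with (i - 1) by lia.
      apply (partial_step w i Q m m1 m2); try easy; try lia.
      intros q Hq. apply H1. lia. }
    rewrite E2 in *.
    eexists. exists s, m'. split; [|easy].
    eapply run_step; [reflexivity|exec; reflexivity|].
    rewrite to_word_eq_1 by lia. destruct (Z.eqb_spec i 1); [lia|].
    apply (run_block w base build_program take_code) with
      (s1 := State 31
        (wfile w base (to_word w i) (cell m (i - 1)) (base + (i - 1)) x8)
        (ufile w base (size m - 1) a b c d e) m1);
      [reflexivity..| |].
    { unfold take_code, goto. cbn [wregs uregs mem]. do 2 step.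
      change (eval_word_op w WAdd base (to_word w i))
        with (to_word w (base + to_word w i)).
      rewrite to_word_add_r, word_pred, (to_word_small w (base + i - 1)) by lia.
      replace (base + i - 1) with (base + (i - 1)) by lia.
      erewrite exec_cons
        by (exec; rewrite read_cell_at by lia; exec; reflexivity).
      erewrite exec_cons by (exec; rewrite W; exec; reflexivity).
      reflexivity. }
    apply (run_block w base build_program update_code) with (3 := E);
      [reflexivity..|].
    eapply run_step; [reflexivity|exec; reflexivity|].
    eapply run_step; [reflexivity|exec; reflexivity|].
    rewrite word_pred. replace (Z.of_nat (S r)) with (i - 1) in Hr by lia.
    exact Hr.
Qed.

(** * Prefix sums of the array and sequences of operations *)

Lemma psum_succ (A : list Z) (q : Z) :
  0 <= q < size A -> psum A (q + 1) = psum A q + cell A q.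
Proof.
  unfold psum, cell, size. intros Hq.
  replace (Z.to_nat (q + 1)) with (S (Z.to_nat q)) by lia.
  assert (Hk : (Z.to_nat q < length A)%nat) by lia. revert Hk.
  generalize (Z.to_nat q) as k. clear. induction A as [|x A IH]; intros k Hk.
  - cbn in Hk. lia.
  - destruct k as [|k]; [cbn; lia|]. cbn in Hk.
    cbn [firstn fold_right nth] in *. rewrite IH by lia. lia.
Qed.

Lemma psum_add_at (A : list Z) (i d q : Z) :
  1 <= i <= size A -> 0 <= q ->
  psum (add_at A i d) q = psum A q + if i <=? q then d else 0.
Proof.
  unfold psum, add_at, size. intros Hi Hq.
  replace (i <=? q) with (Nat.ltb (Z.to_nat (i - 1)) (Z.to_nat q)).
  2:{ apply eq_true_iff_eq. rewrite Nat.ltb_lt, Z.leb_le. lia. }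
  assert (Hk : (Z.to_nat (i - 1) < length A)%nat) by lia. revert Hk.
  generalize (Z.to_nat (i - 1)) as k, (Z.to_nat q) as p. clear.
  induction A as [|x A IH]; intros k p Hk; [cbn in Hk; lia|].
  destruct p as [|p]; [easy|]. destruct k as [|k].
  - cbn. lia.
  - cbn in Hk. specialize (IH k p ltac:(lia)).
    cbn [firstn skipn app fold_right] in *. rewrite IH.
    change (Nat.ltb (S k) (S p)) with (Nat.ltb k p). lia.
Qed.

Lemma size_add_at (A : list Z) (i d : Z) : size (add_at A i d) = size A.
Proof.
  unfold size, add_at. f_equal.
  rewrite <- (firstn_skipn (Z.to_nat (i - 1)) A) at 3.
  rewrite !length_app. now destruct (skipn _ A).
Qed.

(** The shift in [psum A (q + 1)] reconciles cells counted from 0 with array positions counted from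
    1. *)
Lemma run_ops (w base : Z) (ops : list operation) (A : list Z)
    (m : list Z) (s : state) :
  1 <= w -> 0 <= base -> base + size m <= 2 ^ w -> size A = size m ->
  represents w (fun q => psum A (q + 1)) m ->
  machine w base (size m - 1) m s ->
  Forall (valid_op w (size m)) ops ->
  serves w base sum_program update_program
    (35 * (1 + Z.log2 (Z.log2 (size m)))) ops A s.
Proof.
  intros Hw Hb. revert A m s.
  induction ops as [|o ops IH]; intros A m s Hs HA HQ Hk Hops; [easy|].
  inversion Hops as [|? ? Ho Hops']; subst. destruct o as [i|i d]; cbn in Ho.
  - destruct (run_sum w base i _ m s Hw Hb Hs Ho HQ Hk)
      as (t & s' & Hr & Ht & Hres & Hk').
    exists t, s'. split; [exact Hr|]. split; [exact Ht|]. split.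
    + rewrite Hres. do 2 f_equal. lia.
    + exact (IH A m s' Hs HA HQ Hk' Hops').
  - destruct Ho as [Hi _].
    destruct (run_update w base i d (fun q => psum A (q + 1))
      (fun q => psum (add_at A i d) (q + 1)) m s Hw Hb Hs Hi)
      as (t & s' & m' & Hr & Ht & Em & HQ' & Hk'); [|exact HQ|exact Hk|].
    { intros q Hq. rewrite psum_add_at by lia. f_equal.
      destruct (Z.leb_spec i (q + 1)), (Z.leb_spec (i - 1) q); lia. }
    rewrite <- Em in *. exists t, s'. split; [exact Hr|]. split.
    { pose proof (Z.log2_nonneg (Z.log2 (size m'))). lia. }
    apply (IH _ m'); try easy. now rewrite size_add_at.
Qed.

Theorem theorem1 :
  exists (build_p sum_p update_p : program) (k : nat) (C : Z),
  forall (w base : Z) (A : list Z),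
    1 <= w ->
    1 <= Z.of_nat (length A) ->
    Z.log2_up (Z.of_nat (length A)) <= w ->
    0 <= base ->
    base + Z.of_nat (length A) <= 2 ^ w ->
    Forall (wbit w) A ->
    exists (t : nat) (s : state),
      run w base build_p t (initial w base k A) s /\
      forall ops : list operation,
        Forall (valid_op w (Z.of_nat (length A))) ops ->
        serves w base sum_p update_p
          (C * (1 + Z.log2 (Z.log2 (Z.of_nat (length A))))) ops A s.
Proof.
  (* Eight constant and five working ultrawords make 13; the bound 35 of a sum query also covers an
     update. *)
  exists build_program, sum_program, update_program, 13%nat, 35.
  intros w base A Hw HA _ Hb Hs _.
  set (m := map (to_word w) A).
  assert (Em : Z.of_nat (length A) = size m)
    by (unfold m, size; now rewrite length_map).
  rewrite Em in *.
  destruct (exec_masks w base (to_word w (size m)) m Hw Hb Hs HA)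
    as (x1 & x7 & a & b & c & d & e & E).
  assert (Hn : size m = Z.of_nat (S (Z.to_nat (size m - 1)))) by lia.
  destruct (run_build_loop w base (fun q => psum A (q + 1))
    (Z.to_nat (size m - 1)) m x1 x7 0 a b c d e Hw Hb Hs)
    as (t & s & m' & Hr & Em' & HQ & Hk).
  - lia.
  (* At the start [i] is the size, so every cell lies below [i] and only has to hold its entry. *)
  - rewrite <- Hn. intros q Hq. unfold raw.
    destruct (Z.ltb_spec q (size m)); [|lia].
    assert (Hc : cell m q = to_word w (cell A q)).
    (* The default of [nth] is put in the form [to_word w 0] that [map_nth] expects. *)
    { unfold cell, m. change 0 with (to_word w 0) at 1.
      apply map_nth. }
    rewrite Hc. f_equal. destruct (Z.eqb_spec q 0) as [Eq|Eq].
    + subst q. rewrite psum_succ by (unfold size in *; lia). easy.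
    + replace (q - 1 + 1) with q by lia.
      rewrite psum_succ by (unfold size in *; lia). lia.
  - rewrite <- Hn in Hr.
    destruct (run_horner w base (to_word w (size m)) (to_word w (size m)) m
      (11 + t) 0 s Hw ltac:(lia)) as (t' & Hr').
    { apply (run_block w base build_program masks_code) with (3 := E);
        [reflexivity..|exact Hr]. }
    exists (6 + t')%nat, s. split.
    + apply (run_block w base build_program constants_code) with
        (s1 := horner_state w base (to_word w (size m)) (to_word w (size m))
          m 6 0); [reflexivity..| |exact Hr'].
      unfold initial. cbn [app repeat]. rewrite Em. fold m.
      pose proof (Z.pow_gt_lin_r 2 w ltac:(lia) ltac:(lia)).
      pose proof (Z.pow_le_mono_r 2 1 w ltac:(lia) ltac:(lia)).
      rewrite (to_word_small w w) by lia.
      unfold constants_code. do 6 step. unfold eval_word_op.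
      rewrite !Z.add_0_r, (to_word_small w base), (to_word_small w 1),
        (to_word_small w (w - 1)), (to_word_small w (to_word w (size m)))
        by (lia || (apply to_word_range; lia)).
      reflexivity.
    + intros ops Hops. rewrite <- Em' in *.
      now apply (run_ops w base ops A m').
Qed.
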